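(* Let $n\ge 2$, $R>0$, $\Omega=B(0,R)\subset\mathbb{R}^n$ with outward unit normal $\vec{\mathbf n}$. Suppose the forcing term and the initial data are radial: by abuse of notation $c(x)=c(r)$ and $u_0(x)=u_0(r)$ for $|x|=r\in[0,R]$, where $c\in C^1([0,R],[0,\infty))$ and $u_0\in C^2([0,R])$ with $u_0'(R)=0$. Assume that there exist $0<a<b<R$ such that $c(a)=\frac{n-1}{a}$, $c(b)=\frac{n-1}{b}$, and $c(r)<\frac{n-1}{r}$ for all $r\in(a,b)$. Assume further that $$u_0(r)=1\ \text{ for } 0\le r\le a,\qquad u_0(r)\in(0,1)\ \text{ for } a<r<b,\qquad u_0(r)=0\ \text{ for } b\le r\le R.$$ Let $u$ be the unique viscosity solution of $$\begin{cases} u_t=|Du|\,\mathrm{div}\left(\frac{Du}{|Du|}\right)+c(x)|Du| & \text{in }\Omega\times(0,\infty),\\ \frac{\partial u}{\partial\vec{\mathbf n}}=0 & \text{on }\partial\Omega\times[0,\infty),\\ u(x,0)=u_0(x) & \text{on }\overline\Omega,\end{cases}$$ write $u(x,t)=\phi(|x|,t)$, and let $\phi_\infty(r)=\lim_{t\to\infty}\phi(r,t)$. Then $u$ is not globally Lipschitz on $\overline\Omega\times[0,\infty)$ (that is, there is no constant $L$ with $|u(x,t)-u(y,s)|\le L(|x-y|+|t-s|)$ for all $x,y\in\overline\Omega$, $t,s\ge 0$), and $$\phi_\infty(r)=\begin{cases}1 & \text{for } r\le a,\\ 0 & \text{for } a<r\le R.\end{cases}$$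
   Context: Viscosity solutions. Let $\mathcal S^n$ be the set of real symmetric $n\times n$ matrices and, for $x\in\overline\Omega$, $p\in\mathbb{R}^n\setminus\{0\}$, $X\in\mathcal S^n$, put $F(x,p,X)=\mathrm{trace}\left(\left(I-\frac{p\otimes p}{|p|^2}\right)X\right)+c(x)|p|$. For $(x,p,X)\in\overline\Omega\times\mathbb{R}^n\times\mathcal S^n$ let $F_*(x,p,X)=\liminf_{(y,q,Y)\to(x,p,X)}F(y,q,Y)$ and $F^*(x,p,X)=\limsup_{(y,q,Y)\to(x,p,X)}F(y,q,Y)$. An upper semicontinuous $u:\overline\Omega\times[0,\infty)\to\mathbb{R}$ is a viscosity subsolution if $u(\cdot,0)\le u_0$ on $\overline\Omega$ and, for any $\varphi\in C^2(\overline\Omega\times[0,\infty))$, whenever $(\hat x,\hat t)\in\overline\Omega\times(0,\infty)$ is a maximizer of $u-\varphi$: if $\hat x\in\Omega$ then $\varphi_t-F^*(\hat x,D\varphi,D^2\varphi)\le 0$ at $(\hat x,\hat t)$; if $\hat x\in\partial\Omega$ then $\min\{\varphi_t-F^*(\hat x,D\varphi,D^2\varphi),\ \frac{\partial\varphi}{\partial\vec{\mathbf n}}\}\le 0$ at $(\hat x,\hat t)$. A lower semicontinuous $u$ is a viscosity supersolution if $u(\cdot,0)\ge u_0$ on $\overline\Omega$ and, for any such $\varphi$, whenever $(\hat x,\hat t)\in\overline\Omega\times(0,\infty)$ is a minimizer of $u-\varphi$: if $\hat x\in\Omega$ then $\varphi_t-F_*(\hat x,D\varphi,D^2\varphi)\ge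 0$; if $\hat x\in\partial\Omega$ then $\max\{\varphi_t-F_*(\hat x,D\varphi,D^2\varphi),\ \frac{\partial\varphi}{\partial\vec{\mathbf n}}\}\ge 0$. A continuous function is a viscosity solution if it is both a sub- and a supersolution. Existence, uniqueness and the comparison principle are well known in this setting; by radial symmetry the solution depends on $x$ only through $|x|$. *)

(* Defs.v *)
From HB Require Import structures.
From mathcomp Require Import all_boot all_order all_algebra.
From mathcomp Require Import all_classical all_reals all_analysis.

Set Implicit Arguments.
Unset Strict Implicit.
Unset Printing Implicit Defensive.

Import Order.TTheory GRing.Theory Num.Theory.
Import numFieldNormedType.Exports.

Local Open Scope classical_set_scope.
Local Open Scope ring_scope.

(* Classes C^1 and C^2 on a subset [A] of the line; on a closed interval the
   derivatives at the endpoints are one-sided. *)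
Section OneVariable.
Variable R : realType.
Implicit Types (A : set R) (f : R -> R).

Definition has_deriv_within A f (x l : R) : Prop :=
  (f y - f x) / (y - x) @[y --> within A x^'] --> l.

Definition C1_on A f : Prop :=
  exists f' : R -> R, (forall x, A x -> has_deriv_within A f x (f' x))
    /\ {within A, continuous f'}.

Definition C2_on A f : Prop :=
  exists f' : R -> R, (forall x, A x -> has_deriv_within A f x (f' x))
    /\ C1_on A f'.

End OneVariable.

Section Problem.
Variables (R : realType) (n : nat).

Notation space := 'rV[R]_n.
Notation spacetime := ('rV[R]_n * R)%type.

Implicit Types (x p e : space) (z : spacetime) (X : 'M[R]_n)
  (u phi : spacetime -> R).

(* Euclidean norm; the library norm [`|x|] on row vectors is the sup norm. *)
Definition enorm x : R := Num.sqrt (\sum_(i < n) x 0 i ^+ 2).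

(* Since the dimension is finite, continuity of all directional derivatives up
   to order 2 is the usual class C^2 on R^n x R. *)
Definition C1 phi : Prop :=
  continuous phi /\
  forall v : spacetime, (forall z, derivable phi z v) /\ continuous ('D_v phi).

Definition C2 phi : Prop := C1 phi /\ forall v : spacetime, C1 ('D_v phi).

Definition sp_dir (i : 'I_n) : spacetime := (delta_mx 0 i, 0).

Definition time_deriv phi z : R := 'D_((0, 1) : spacetime) phi z.

Definition gradient phi z : space := \row_(i < n) 'D_(sp_dir i) phi z.

Definition hessian phi z : 'M[R]_n :=
  \matrix_(i < n, j < n) 'D_(sp_dir i) ('D_(sp_dir j) phi) z.

(* [rho] is the radius of the ball Omega, [c] and [u0] are the radial profiles
   of the forcing term and of the initial datum. *)
Variables (rho : R) (c u0 : R -> R).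

Definition cylinder : set spacetime := [set z | enorm z.1 <= rho /\ 0 <= z.2].

(* Derivative along the outward unit normal [x / |x|], for [|x| = rho]. *)
Definition normal_deriv phi z : R :=
  'D_(((enorm z.1)^-1 *: z.1, 0) : spacetime) phi z.

Notation arg := ('rV[R]_n * 'rV[R]_n * 'M[R]_n)%type.

Definition F_dom : set arg :=
  [set w | [/\ enorm w.1.1 <= rho, w.1.2 != 0 & w.2^T = w.2]].

Definition F (w : arg) : R :=
  let: (x, p, X) := w in
  \tr ((1%:M - (enorm p ^- 2) *: (p^T *m p)) *m X) + c (enorm x) * enorm p.

Definition F_usc (w : arg) : \bar R :=
  limf_esup (fun w' => (F w')%:E) (within F_dom (nbhs w)).

Definition F_lsc (w : arg) : \bar R :=
  limf_einf (fun w' => (F w')%:E) (within F_dom (nbhs w)).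

(* Semicontinuity relative to the closed cylinder. *)
Definition lsc_on_cylinder u : Prop :=
  @lower_semicontinuous (subspace cylinder) R (fun z => (u z)%:E).

Definition usc_on_cylinder u : Prop := lsc_on_cylinder (fun z => - u z).

(* Test functions in C^2 of the closed cylinder are taken as restrictions of
   C^2 functions on R^n x R (Whitney extension), so that all their derivatives
   make sense at boundary points. *)
Definition viscosity_subsolution u : Prop :=
  [/\ usc_on_cylinder u,
      (forall x, enorm x <= rho -> u (x, 0) <= u0 (enorm x)) &
      forall phi z, C2 phi -> cylinder z -> 0 < z.2 ->
        (forall w, cylinder w -> u w - phi w <= u z - phi z) ->
        let E := ((time_deriv phi z)%:E
                  - F_usc (z.1, gradient phi z, hessian phi z))%E in
        (enorm z.1 < rho -> (E <= 0)%E) /\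
        (enorm z.1 = rho -> (mine E (normal_deriv phi z)%:E <= 0)%E)].

Definition viscosity_supersolution u : Prop :=
  [/\ lsc_on_cylinder u,
      (forall x, enorm x <= rho -> u0 (enorm x) <= u (x, 0)) &
      forall phi z, C2 phi -> cylinder z -> 0 < z.2 ->
        (forall w, cylinder w -> u z - phi z <= u w - phi w) ->
        let E := ((time_deriv phi z)%:E
                  - F_lsc (z.1, gradient phi z, hessian phi z))%E in
        (enorm z.1 < rho -> (0 <= E)%E) /\
        (enorm z.1 = rho -> (0 <= maxe E (normal_deriv phi z)%:E)%E)].

Definition viscosity_solution u : Prop :=
  [/\ {within cylinder, continuous u},
      viscosity_subsolution u & viscosity_supersolution u].

Definition globally_lipschitz u : Prop :=
  exists L : R, forall x y (t s : R),
    cylinder (x, t) -> cylinder (y, s) ->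
    `|u (x, t) - u (y, s)| <= L * (enorm (x - y) + `|t - s|).

(* The radial profile [r, t |-> u (r e, t)], read off along a unit vector [e]:
   if [u (x, t) = phi (|x|, t)] then this is [phi], whatever [e]. *)
Definition profile u e (r t : R) : R := u (r *: e, t).

End Problem.

(* Main.v *)
Require Import Defs.
From HB Require Import structures.
From mathcomp Require Import all_boot all_order all_algebra.
From mathcomp Require Import all_classical all_reals all_analysis.
From mathcomp Require Import ring lra.
Import Order.TTheory GRing.Theory Num.Theory.
Import numFieldNormedType.Exports.
Set Implicit Arguments.
Unset Strict Implicit.
Unset Printing Implicit Defensive.
Local Open Scope classical_set_scope.
Local Open Scope ring_scope.

(** Smooth strict super- and subsolutions bound [u], since the definition of a
    viscosity solution can be tested against them directly; no comparison
    principle is needed. With [s = |x|^2] and [y_+ = max y 0], two radially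
    monotone families of barriers suffice.
    - From below, [al - be t - m e^(K t) (s - a^2)_+^3]: since [n - 1 - c(r) r]
      vanishes at [r = a] and is at most [C (r^2 - a^2)] beyond, this is a
      subsolution for [K = 6 C]. As [m -> 0] with [al = 0] it gives [u >= 0], and
      with [al -> 1] it gives [u >= 1] for [|x| <= a].
    - From above, [al + be t + m e^(K t) (q(t) - s)_+^3 + eps (s - q1)_+^3] with
      [q(t)] decreasing slowly from [q1 < b^2] to [q2 > a^2]: the level sets of a
      decreasing profile shrink strictly as long as their radius is in [(a, b)].
      The last term makes the outward normal derivative positive. This gives
      [u <= 1] and, for every [r > a], [u <= al] at radius [r] for large times.
    The limit profile jumps at [a], so [u] cannot be globally Lipschitz. *)

(** * Calculus of radial functions *)

Lemma derive_linear (R : realType) (V : normedModType R) (l : V -> R) (z v : V) :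
  linear l -> continuous l -> differentiable l z /\ 'D_v l z = l v.
Proof.
move=> ll lc.
pose L : {linear V -> R} := HB.pack l (GRing.isLinear.Build _ _ _ _ _ ll).
have dL : differentiable L z by exact: linear_differentiable.
split; first exact: dL.
by rewrite -[l]/(L : _ -> _) deriveE// diff_lin.
Qed.

Lemma derive_comp (R : realType) (V : normedModType R) (f f' : R -> R)
    (phi : V -> R) (z v : V) :
  (forall x : R, is_derive x 1 f (f' x)) -> differentiable phi z ->
  differentiable (f \o phi) z /\ 'D_v (f \o phi) z = f' (phi z) * 'D_v phi z.
Proof.
move=> df dphi.
have dfp : differentiable f (phi z).
  by apply/derivable1_diffP; have [] := df (phi z).
split; first exact: differentiable_comp.
rewrite deriveE; last exact: differentiable_comp.
rewrite diff_comp//= diff1E// -deriveE// derive1E.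
by rewrite (@derive_val _ _ _ _ _ _ _ (df (phi z))) mulrC.
Qed.

Lemma cvg_sumr (R : realType) (T : Type) (G : set_system T) (I : finType)
    (F : I -> T -> R) (l : I -> R) : Filter G ->
  (forall i, F i a @[a --> G] --> l i) ->
  \sum_i F i a @[a --> G] --> \sum_i l i.
Proof. by move=> FG h; apply: cvg_big => //; exact: add_continuous. Qed.

Section Smooth.
Variables (R : realType) (n : nat).
Notation spacetime := ('rV[R]_n * R)%type.
Implicit Types (phi psi : spacetime -> R) (x y : 'rV[R]_n) (z v : spacetime).

Definition ip x y : R := \sum_(i < n) x 0 i * y 0 i.

Lemma ip_linear y : linear (fun z : spacetime => ip z.1 y).
Proof.
move=> k z w; rewrite /ip scaler_sumr -big_split/=; apply: eq_bigr => i _.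
by rewrite !mxE /GRing.scale/=; ring.
Qed.

Lemma coord1_continuous i : continuous (fun z : spacetime => z.1 0 i).
Proof.
move=> z.
apply: (@continuous_comp _ _ _ fst (fun x : 'rV[R]_n => x 0 i)).
  exact: cvg_fst.
exact: coord_continuous.
Qed.

Lemma sum_continuous (T : topologicalType) (I : finType) (F : I -> T -> R) :
  (forall i, continuous (F i)) -> continuous (fun a : T => \sum_i F i a).
Proof.
by move=> cF z; apply: cvg_sumr => i; exact: cF.
Qed.

Lemma ip_continuous y : continuous (fun z : spacetime => ip z.1 y).
Proof.
apply: sum_continuous => i z; apply: cvgM; last exact: cvg_cst.
exact: coord1_continuous.
Qed.

(** Full differentiability, rather than the directional derivatives of [C1], is what the chain rule
    requires. *)
Definition smooth1 phi := (forall z, differentiable phi z) /\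
  forall v, continuous ('D_v phi).

Lemma smooth1_C1 phi : smooth1 phi -> C1 phi.
Proof.
move=> [dphi cphi]; split; first by move=> z; exact: differentiable_continuous.
by move=> v; split => // z; exact: diff_derivable.
Qed.

Lemma smooth1D phi psi : smooth1 phi -> smooth1 psi ->
  smooth1 (fun z => phi z + psi z).
Proof.
move=> [d1 c1] [d2 c2]; split=> [z|v]; first exact: differentiableD.
rewrite (_ : 'D_v _ = fun z => 'D_v phi z + 'D_v psi z); last first.
  by apply/funext => z; rewrite deriveD//; exact: diff_derivable.
by move=> z; apply: cvgD; [exact: c1|exact: c2].
Qed.

Lemma smooth1M phi psi : smooth1 phi -> smooth1 psi ->
  smooth1 (fun z => phi z * psi z).
Proof.
move=> [d1 c1] [d2 c2]; split=> [z|v]; first exact: differentiableM.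
rewrite (_ : 'D_v _ = fun z => phi z * 'D_v psi z + psi z * 'D_v phi z); last first.
  by apply/funext => z; rewrite deriveM//; exact: diff_derivable.
move=> z; apply: cvgD; apply: cvgM.
- exact/differentiable_continuous.
- exact: c2.
- exact/differentiable_continuous.
- exact: c1.
Qed.

Lemma smooth1_linear (l : spacetime -> R) :
  linear l -> continuous l -> smooth1 l.
Proof.
move=> ll lc; split=> [z|v]; first by have [] := derive_linear z z ll lc.
rewrite (_ : 'D_v l = cst (l v)); first exact: cst_continuous.
by apply/funext => z; have [] := derive_linear z v ll lc.
Qed.

Lemma smooth1_cst (k : R) : smooth1 (fun=> k).
Proof.
split=> [z|v]; first exact: differentiable_cst.
rewrite (_ : 'D_v _ = cst 0); first exact: cst_continuous.
by apply/funext => z; exact: derive_cst.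
Qed.

(* [phi] is of the form [h (|x|^2, t)], with [ht] and [hs] the partial
   derivatives of [h] in [t] and in [s = |x|^2]. *)
Definition radial_C1 phi (ht hs : spacetime -> R) :=
  [/\ forall z, differentiable phi z, continuous ht, continuous hs &
  forall z v, 'D_v phi z = ht z * v.2 + 2 * hs z * ip z.1 v.1].

Lemma radial_C1_smooth1 phi ht hs : radial_C1 phi ht hs -> smooth1 phi.
Proof.
move=> [d ct cs e]; split => // v.
rewrite (_ : 'D_v _ = fun z => ht z * v.2 + 2 * hs z * ip z.1 v.1); last first.
  by apply/funext => z; exact: e.
move=> z; apply: cvgD; apply: cvgM => //; [exact: ct|exact: cvg_cst| |].
  by apply: cvgM; [exact: cvg_cst|exact: cs].
exact: ip_continuous.
Qed.

Lemma radial_C1_cst (k : R) : radial_C1 (fun=> k) (fun=> 0) (fun=> 0).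
Proof.
split=> [z|||z v].
- exact: differentiable_cst.
- exact: cst_continuous.
- exact: cst_continuous.
- by rewrite derive_cst; ring.
Qed.

Lemma radial_C1D phi ht hs psi kt ks :
  radial_C1 phi ht hs -> radial_C1 psi kt ks ->
  radial_C1 (fun z => phi z + psi z) (fun z => ht z + kt z)
    (fun z => hs z + ks z).
Proof.
move=> [d ct cs e] [d' ct' cs' e']; split=> [z|z|z|z v].
- exact: differentiableD.
- by apply: cvgD; [exact: ct|exact: ct'].
- by apply: cvgD; [exact: cs|exact: cs'].
- by rewrite deriveD ?e ?e'//; [ring|exact: diff_derivable|exact: diff_derivable].
Qed.

Lemma radial_C1M phi ht hs psi kt ks :
  radial_C1 phi ht hs -> radial_C1 psi kt ks ->
  radial_C1 (fun z => phi z * psi z) (fun z => ht z * psi z + phi z * kt z)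
    (fun z => hs z * psi z + phi z * ks z).
Proof.
move=> [d ct cs e] [d' ct' cs' e'].
have cphi : continuous phi by move=> z; exact: differentiable_continuous.
have cpsi : continuous psi by move=> z; exact: differentiable_continuous.
split=> [z|z|z|z v].
- exact: differentiableM.
- by apply: cvgD; apply: cvgM; [exact: ct|exact: cpsi|exact: cphi|exact: ct'].
- by apply: cvgD; apply: cvgM; [exact: cs|exact: cpsi|exact: cphi|exact: cs'].
- rewrite deriveM ?e ?e'//; try exact: diff_derivable.
  by rewrite /GRing.scale/=; ring.
Qed.

Lemma radial_C1_comp (f f' : R -> R) phi ht hs :
  (forall x : R, is_derive x 1 f (f' x)) -> continuous f' -> radial_C1 phi ht hs ->
  radial_C1 (fun z => f (phi z)) (fun z => f' (phi z) * ht z)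
    (fun z => f' (phi z) * hs z).
Proof.
move=> df cf' [d ct cs e].
have cfp : continuous (f' \o phi).
  move=> z; apply: continuous_comp; last exact: cf'.
  exact: differentiable_continuous.
split=> [z|z|z|z v].
- by have [] := derive_comp z df (d z).
- by apply: cvgM; [exact: cfp|exact: ct].
- by apply: cvgM; [exact: cfp|exact: cs].
- by have [_ ->] := derive_comp v df (d z); rewrite e; ring.
Qed.

Lemma radial_C1_time : radial_C1 snd (fun=> 1) (fun=> 0).
Proof.
have l : linear (snd : spacetime -> R) by [].
have c : continuous (snd : spacetime -> R) by move=> z; exact: cvg_snd.
split=> [z|||z v].
- by have [] := derive_linear z z l c.
- exact: cst_continuous.
- exact: cst_continuous.
- by have [_ ->] := derive_linear z v l c; ring.
Qed.

Definition sqn z : R := ip z.1 z.1.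

Lemma radial_C1_sqn : radial_C1 sqn (fun=> 0) (fun=> 1).
Proof.
pose co i (z : spacetime) := z.1 0 i.
have l i : linear (co i) by move=> k z w; rewrite /co !mxE.
have c i : continuous (co i) by exact: coord1_continuous.
have E : sqn = \sum_(i < n) (fun z => co i z * co i z).
  by apply/funext => z; rewrite fct_sumE.
have D i z : differentiable (fun z => co i z * co i z) z.
  by apply: differentiableM; have [] := derive_linear z z (l i) (c i).
split=> [z|||z v].
- by rewrite E; apply: differentiable_sum.
- exact: cst_continuous.
- exact: cst_continuous.
- rewrite E derive_sum; last by move=> i; exact: diff_derivable.
  rewrite mul0r add0r mulr1 mulr_sumr; apply: eq_bigr => i _.
  have [d e] := derive_linear z v (l i) (c i).
  by rewrite deriveM ?e; [rewrite /GRing.scale/= /co; ring|exact: diff_derivable..].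
Qed.

(* In addition [hss] is the second derivative of [h] in [s]. *)
Definition radial_C2 phi ht hs hss :=
  [/\ radial_C1 phi ht hs, (exists kt ks, radial_C1 ht kt ks) &
  exists kt, radial_C1 hs kt hss].

Lemma radial_C2D phi ht hs hss psi kt ks kss :
  radial_C2 phi ht hs hss -> radial_C2 psi kt ks kss ->
  radial_C2 (fun z => phi z + psi z) (fun z => ht z + kt z)
    (fun z => hs z + ks z) (fun z => hss z + kss z).
Proof.
move=> [p1 [? [? p2]] [? p3]] [q1 [? [? q2]] [? q3]]; split.
- exact: radial_C1D.
- by do 2 eexists; exact: radial_C1D p2 q2.
- by eexists; exact: radial_C1D p3 q3.
Qed.

Lemma radial_C2_cst (k : R) : radial_C2 (fun=> k) (fun=> 0) (fun=> 0) (fun=> 0).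
Proof.
split; first exact: radial_C1_cst.
- by do 2 eexists; exact: radial_C1_cst.
- by eexists; exact: radial_C1_cst.
Qed.

Lemma radial_C2_time : radial_C2 snd (fun=> 1) (fun=> 0) (fun=> 0).
Proof.
split; first exact: radial_C1_time.
- by do 2 eexists; exact: radial_C1_cst.
- by eexists; exact: radial_C1_cst.
Qed.

Lemma radial_C2_sqn : radial_C2 sqn (fun=> 0) (fun=> 1) (fun=> 0).
Proof.
split; first exact: radial_C1_sqn.
- by do 2 eexists; exact: radial_C1_cst.
- by eexists; exact: radial_C1_cst.
Qed.

Lemma radial_C2M phi ht hs hss psi kt ks kss :
  radial_C2 phi ht hs hss -> radial_C2 psi kt ks kss ->
  radial_C2 (fun z => phi z * psi z) (fun z => ht z * psi z + phi z * kt z)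
    (fun z => hs z * psi z + phi z * ks z)
    (fun z => hss z * psi z + hs z * ks z + (hs z * ks z + phi z * kss z)).
Proof.
move=> [p1 [? [? p2]] [? p3]] [q1 [? [? q2]] [? q3]]; split.
- exact: radial_C1M.
- by do 2 eexists; exact: radial_C1D (radial_C1M p2 q1) (radial_C1M p1 q2).
- by eexists; exact: radial_C1D (radial_C1M p3 q1) (radial_C1M p1 q3).
Qed.

Lemma radial_C2_comp (f f' f'' : R -> R) phi ht hs hss :
  (forall x : R, is_derive x 1 f (f' x)) ->
  (forall x : R, is_derive x 1 f' (f'' x)) -> continuous f'' ->
  radial_C2 phi ht hs hss ->
  radial_C2 (fun z => f (phi z)) (fun z => f' (phi z) * ht z)
    (fun z => f' (phi z) * hs z)
    (fun z => f'' (phi z) * hs z * hs z + f' (phi z) * hss z).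
Proof.
move=> df df' cf'' [p1 [? [? p2]] [? p3]].
have cf' : continuous f'.
  move=> x; apply/differentiable_continuous/derivable1_diffP.
  by have [] := df' x.
split; first exact: radial_C1_comp.
- by do 2 eexists; exact: radial_C1M (radial_C1_comp df' cf'' p1) p2.
- by eexists; exact: radial_C1M (radial_C1_comp df' cf'' p1) p3.
Qed.

(** The closure lemmas produce derivatives in unsimplified form; this trades them for pointwise
    equal ones. *)
Lemma radial_C2_eq phi psi ht hs hss ht' hs' hss' : radial_C2 phi ht hs hss ->
  phi =1 psi -> ht =1 ht' -> hs =1 hs' -> hss =1 hss' ->
  radial_C2 psi ht' hs' hss'.
Proof. by move=> + /funext <- /funext <- /funext <- /funext <-. Qed.

Section RadialC2.
Variables (phi ht hs hss : spacetime -> R).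
Hypothesis phiC2 : radial_C2 phi ht hs hss.

(** The derivative in direction [v] is built by sums and products from [ht], [hs], constants and one
    linear function of $x$, all of class [smooth1]. *)
Lemma radial_C2_C2 : C2 phi.
Proof.
have [p1 [kt [ks p2]] [lt p3]] := phiC2.
split; first exact/smooth1_C1/(radial_C1_smooth1 p1).
move=> v; apply: smooth1_C1.
have [_ _ _ e] := p1.
rewrite (_ : 'D_v _ = fun z => ht z * v.2 + 2 * hs z * ip z.1 v.1); last first.
  by apply/funext => z; exact: e.
apply: smooth1D; apply: smooth1M; [exact: radial_C1_smooth1 p2|exact: smooth1_cst| |].
  apply: smooth1M; [exact: smooth1_cst|exact: radial_C1_smooth1 p3].
by apply: smooth1_linear; [exact: ip_linear|exact: ip_continuous].
Qed.

Lemma ip_delta x i : ip x (delta_mx 0 i) = x 0 i.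
Proof.
rewrite /ip (bigD1 i)//= big1 ?addr0 => [|j ji]; rewrite !mxE.
  by rewrite !eqxx mulr1.
by rewrite (negbTE ji) andbF mulr0.
Qed.

Lemma radial_time_deriv z : time_deriv phi z = ht z.
Proof.
have [[_ _ _ e] _ _] := phiC2.
rewrite /time_deriv e /= /ip big1 ?mulr0 ?addr0 ?mulr1// => i _.
by rewrite mxE mulr0.
Qed.

Lemma radial_gradient z : gradient phi z = (2 * hs z) *: z.1.
Proof.
have [[_ _ _ e] _ _] := phiC2.
apply/matrixP => i j; rewrite !mxE e /= ip_delta (ord1 i); ring.
Qed.

(** Differentiating $2 h_s x_j$ in direction $i$, the factor $x_j$ gives the scalar matrix and the
    factor $h_s$ the rank-one term. *)
Lemma radial_hessian z :
  hessian phi z = (2 * hs z)%:M + (4 * hss z) *: (z.1^T *m z.1).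
Proof.
have [[_ _ _ e] _ [lt p3]] := phiC2.
apply/matrixP => i j; rewrite !mxE big_ord1 !mxE.
rewrite (_ : 'D_(sp_dir R j) _ = fun z => 2 *: hs z * ip z.1 (delta_mx 0 j)); last first.
  by apply/funext => w; rewrite e /= mulr0 add0r.
have [d _ _ e'] := p3.
have [ld le] := derive_linear z (sp_dir R i) (@ip_linear (delta_mx 0 j))
  (@ip_continuous (delta_mx 0 j)).
have dd : differentiable (fun z => 2 *: hs z) z by exact: differentiableZ.
rewrite deriveM ?le; [|exact: diff_derivable..].
rewrite deriveZ; last exact: diff_derivable.
rewrite e' /= !ip_delta !mxE eqxx /GRing.scale/= eq_sym.
by case: eqP => _ /=; rewrite ?mulr1n ?mulr0n; ring.
Qed.

Lemma radial_normal_deriv rho z : 0 < rho -> enorm z.1 = rho ->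
  normal_deriv phi z = 2 * hs z * rho.
Proof.
move=> r0 zr; have [[_ _ _ e] _ _] := phiC2.
rewrite /normal_deriv e /= mulr0 add0r zr.
have -> : ip z.1 (rho^-1 *: z.1) = rho^-1 * rho ^+ 2.
  rewrite -zr /enorm sqr_sqrtr; last by apply: sumr_ge0 => i _; exact: sqr_ge0.
  rewrite mulr_sumr; apply: eq_bigr => i _; rewrite !mxE; ring.
by rewrite expr2 mulKf// gt_eqF.
Qed.

End RadialC2.

End Smooth.

(** * Limits of the operator at radial test functions *)

(** On the set of the filter where $|l - f| \le e$, the supremum is at most $l + e$. Only one
    inequality is claimed, for a possibly improper filter, so it applies to [F_usc] without showing
    that [F_dom] accumulates at the point. *)
Lemma limf_esup_le (R : realType) (T : choiceType) (X : filteredType T) (f : X -> R)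
    (G : set_system X) (l : R) : Filter G ->
  f @ G --> l -> (limf_esup (fun a : X => (f a)%:E) G <= l%:E)%E.
Proof.
move=> FG /cvgrPdist_le fl; apply/lee_addgt0Pr => e e0.
rewrite limf_esupE; have := fl e e0; rewrite near_map => h.
apply: (@le_trans _ _ (ereal_sup ((fun a : X => (f a)%:E) @` [set a | `|l - f a| <= e]))).
  by apply: ereal_inf_lbound; exists [set a | `|l - f a| <= e].
apply: ge_ereal_sup => _ [a /= la <-]; rewrite -EFinD lee_fin.
by move: la; rewrite ler_distlC => /andP[].
Qed.

Lemma limf_einf_ge (R : realType) (T : choiceType) (X : filteredType T) (f : X -> R)
    (G : set_system X) (l : R) : Filter G ->
  f @ G --> l -> (l%:E <= limf_einf (fun a : X => (f a)%:E) G)%E.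
Proof.
move=> FG fl; rewrite /limf_einf leeNr -EFinN.
by apply: (@limf_esup_le _ _ _ (fun a : X => - f a)); exact: cvgN.
Qed.

Section Operator.
Variables (R : realType) (n : nat).
Implicit Types (x p : 'rV[R]_n) (X : 'M[R]_n).
Notation arg := ('rV[R]_n * 'rV[R]_n * 'M[R]_n)%type.
Implicit Types w : arg.

Lemma enorm_ge0 x : 0 <= enorm x.
Proof. exact: sqrtr_ge0. Qed.

Lemma sqr_enorm x : enorm x ^+ 2 = ip x x.
Proof. by rewrite sqr_sqrtr//; apply: sumr_ge0 => i _; exact: sqr_ge0. Qed.

Lemma enorm_eq0 x : (enorm x == 0) = (x == 0).
Proof.
apply/idP/eqP => [|->]; last first.
  rewrite /enorm big1 ?sqrtr0// => i _; by rewrite mxE expr0n.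
move=> /eqP x0; have := sqr_enorm x; rewrite x0 expr0n/= => /esym/eqP.
rewrite psumr_eq0 => [/allP s|i _]; last exact: sqr_ge0.
apply/rowP => i; rewrite mxE; apply/eqP.
by have := s i (mem_index_enum i); rewrite mulf_eq0 orbb.
Qed.

Lemma enorm0 : enorm (0 : 'rV[R]_n) = 0.
Proof. by apply/eqP; rewrite enorm_eq0. Qed.

Lemma enormZ (k : R) x : enorm (k *: x) = `|k| * enorm x.
Proof.
rewrite /enorm -sqrtr_sqr -sqrtrM ?sqr_ge0//; congr Num.sqrt.
by rewrite mulr_sumr; apply: eq_bigr => i _; rewrite mxE exprMn.
Qed.

Lemma enorm_continuous : continuous (@enorm R n).
Proof.
move=> x; apply: (@continuous_comp _ _ _ (fun x => \sum_(i < n) x 0 i ^+ 2)).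
  apply: sum_continuous => i {}x.
  apply: (@continuous_comp _ _ _ (fun x : 'rV[R]_n => x 0 i) (fun a => a ^+ 2)).
    exact: coord_continuous.
  exact: exprn_continuous.
exact: sqrt_continuous.
Qed.

Lemma coord_le_enorm x i : `|x 0 i| <= enorm x.
Proof.
rewrite -sqrtr_sqr; apply: ler_wsqrtr.
by rewrite (bigD1 i)//= lerDl sumr_ge0// => j _; exact: sqr_ge0.
Qed.

(** The trace of $(p^T p) X$, as a double sum so that limits can be taken entrywise. *)
Definition quad p X : R := \sum_(i < n) \sum_(j < n) p 0 i * p 0 j * X j i.

Lemma FE (c : R -> R) x p X :
  F c (x, p, X) = \tr X - enorm p ^- 2 * quad p X + c (enorm x) * enorm p.
Proof.
rewrite /F mulmxBl mul1mx -scalemxAl raddfB/= mxtraceZ; congr (_ - _ * _ + _).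
rewrite /mxtrace; apply: eq_bigr => i _; rewrite mxE; apply: eq_bigr => j _.
by rewrite mxE big_ord1 mxE.
Qed.

Variables (rho : R) (c : R -> R).
Hypothesis c_cont : {within `[0, rho], continuous c}.

Definition F_filter w := within (F_dom rho) (nbhs w).

Instance F_filter_filter w : Filter (F_filter w).
Proof. exact: within_filter. Qed.

Lemma F_cvg_x w : w'.1.1 @[w' --> F_filter w] --> w.1.1.
Proof.
apply: cvg_within_filter; apply: (@continuous_comp _ _ _ fst fst); exact: cvg_fst.
Qed.

Lemma F_cvg_p w : w'.1.2 @[w' --> F_filter w] --> w.1.2.
Proof.
apply: cvg_within_filter.
by apply: (@continuous_comp _ _ _ fst snd); [exact: cvg_fst|exact: cvg_snd].
Qed.

Lemma F_cvg_X w (i j : 'I_n) : (fun w' : arg => w'.2 i j) @ F_filter w --> w.2 i j.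
Proof.
apply: cvg_within_filter.
apply: (@continuous_comp _ _ _ snd (fun X : 'M[R]_n => X i j)).
  exact: cvg_snd.
exact: coord_continuous.
Qed.

Lemma F_cvg_pi w i : (fun w' : arg => w'.1.2 0 i) @ F_filter w --> w.1.2 0 i.
Proof.
apply: (cvg_comp (fun w' : arg => w'.1.2) (fun p => p 0 i) (@F_cvg_p w)).
exact: coord_continuous.
Qed.

Lemma F_cvg_norm w : enorm w'.1.2 @[w' --> F_filter w] --> enorm w.1.2.
Proof.
apply: (cvg_comp (fun w' : arg => w'.1.2) (@enorm R n) (@F_cvg_p w)).
exact: enorm_continuous.
Qed.

Lemma F_cvg_tr w : (fun w' : arg => \tr w'.2) @ F_filter w --> \tr w.2.
Proof. by apply: cvg_sumr => i; exact: F_cvg_X. Qed.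

Lemma F_cvg_c w : enorm w.1.1 <= rho ->
  c (enorm w'.1.1) @[w' --> F_filter w] --> c (enorm w.1.1).
Proof.
move=> xr.
(* Since [c] is continuous only relative to [[0, rho]], the norms must converge inside that
   interval; [F_dom] keeps them there. *)
have e : enorm w'.1.1 @[w' --> F_filter w] -->
    within `[0, rho]%classic (nbhs (enorm w.1.1)).
  have h : enorm w'.1.1 @[w' --> F_filter w] --> enorm w.1.1.
    apply: (cvg_comp (fun w' : arg => w'.1.1) (@enorm R n) (@F_cvg_x w)).
    exact: enorm_continuous.
  move=> A; rewrite /within/= => /h/=; rewrite !nbhs_simpl/= => hA.
  have : F_filter w (F_dom rho) by exact: withinT.
  apply: filterS2 hA => w' /= hA [w1 _ _]; apply: hA.
  by rewrite /= in_itv/= enorm_ge0.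
apply: (cvg_comp (fun w' : arg => enorm w'.1.1) c e).
move/subspace_continuousP : c_cont; apply.
by rewrite /= in_itv/= enorm_ge0.
Qed.

Lemma F_cvg_nz w : enorm w.1.2 != 0 -> enorm w.1.1 <= rho ->
  F c w' @[w' --> F_filter w] --> F c w.
Proof.
move=> p0 xr; case: w p0 xr => [[x p] X] p0 xr.
rewrite FE (_ : F c = fun w => \tr w.2 - enorm w.1.2 ^- 2 * quad w.1.2 w.2
   + c (enorm w.1.1) * enorm w.1.2); last first.
  by apply/funext => -[[y q] Y]; rewrite FE.
apply: cvgD; last by apply: cvgM; [exact: F_cvg_c|exact: F_cvg_norm].
apply: cvgB; first exact: F_cvg_tr.
apply: cvgM.
  apply: cvgV; first by rewrite expf_neq0.
  by apply: cvgM; exact: F_cvg_norm.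
apply: cvg_sumr => i; apply: cvg_sumr => j.
by apply: cvgM; [apply: cvgM; exact: F_cvg_pi|exact: F_cvg_X].
Qed.

(* Near [p = 0] the projection [I - p p^T / |p|^2] oscillates, but its trace is
   constant, so the limit of [F] still exists when [X] is a scalar matrix. *)
Lemma F_cvg_0 (x : 'rV[R]_n) (al : R) : enorm x <= rho ->
  F c w' @[w' --> F_filter (x, 0, al%:M)] --> (n%:R - 1) * al.
Proof.
move=> xr; set w : arg := (x, 0, al%:M).
(* The error made by replacing $X$ with $al\, I$ in the quadratic form. As $|p_i p_j| \le |p|^2$, it
   is bounded by the sum [B] of the entries of $|X - al\, I|$, whatever the direction of $p$. *)
pose Q (w' : arg) := - (enorm w'.1.2 ^- 2 * quad w'.1.2 (w'.2 - al%:M)).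
have Q0 : Q w' @[w' --> F_filter w] --> 0.
  apply/norm_cvg0P.
  pose B (w' : arg) : R := \sum_(i < n) \sum_(j < n) `|w'.2 j i - al%:M j i|.
  apply: (@squeeze_cvgr _ _ _ _ (cst 0) B); last 2 first.
  - exact: cvg_cst.
  - rewrite [X in _ --> X](_ : 0 = \sum_(i < n) \sum_(j < n) `|w.2 j i - al%:M j i|);
      last by rewrite big1// => i _; rewrite big1// => j _; rewrite subrr normr0.
    apply: cvg_sumr => i; apply: cvg_sumr => j; apply: cvg_norm.
    by apply: cvgB; [exact: F_cvg_X|exact: cvg_cst].
  have : F_filter w (F_dom rho) by exact: withinT.
  apply: filterS => -[[y q] Y] [/= _ q0 _]; rewrite normr_ge0/=.
  rewrite /Q/= normrN normrM ger0_norm ?invr_ge0 ?sqr_ge0//.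
  have nq : 0 < enorm q by rewrite lt_def enorm_ge0 enorm_eq0 q0.
  rewrite mulrC ler_pdivrMr ?exprn_gt0//.
  apply: le_trans (ler_norm_sum _ _ _) _; rewrite /B mulr_suml/=.
  apply: ler_sum => i _; apply: le_trans (ler_norm_sum _ _ _) _; rewrite mulr_suml/=.
  apply: ler_sum => j _; rewrite !normrM mulrC !mxE ler_wpM2l//.
  by rewrite expr2 ler_pM// coord_le_enorm.
(* For $p \ne 0$ the scalar part of $X$ contributes exactly [al] to the normalized quadratic form,
   so this function agrees with [F c] on [F_dom]. *)
have E : (fun w' : arg => \tr w'.2 - al + Q w' + c (enorm w'.1.1) * enorm w'.1.2)
    w' @[w' --> F_filter w] --> \tr w.2 - al + 0 + c (enorm x) * enorm w.1.2.
  apply: cvgD; last by apply: cvgM; [exact: F_cvg_c|exact: F_cvg_norm].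
  apply: cvgD => //; apply: cvgB; [exact: F_cvg_tr|exact: cvg_cst].
rewrite (_ : _ * al = \tr w.2 - al + 0 + c (enorm x) * enorm w.1.2); last first.
  have -> : \tr w.2 = n%:R * al by rewrite mxtrace_scalar mulr_natl.
  by rewrite enorm0; ring.
apply: cvg_trans E; apply: near_eq_cvg.
have : F_filter w (F_dom rho) by exact: withinT.
apply: filterS => -[[y q] Y] [_ q0 _]; rewrite FE /Q /= in q0 *; congr (_ + _).
rewrite -addrA; congr (_ + _).
have -> : quad q (Y - al%:M) = quad q Y + - al * enorm q ^+ 2.
  apply/eqP; rewrite [eqbRHS]addrC -subr_eq; apply/eqP.
  rewrite sqr_enorm /ip /quad -sumrB mulr_sumr; apply: eq_bigr => i _.
  rewrite -sumrB (bigD1 i)//= big1 ?addr0 => [|j ji]; rewrite !mxE.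
    by rewrite eqxx mulr1n; ring.
  by rewrite (negbTE ji) mulr0n subr0 subrr.
by field; rewrite enorm_eq0.
Qed.

(** The value of $F$ at the gradient $2 h_s x$ and the Hessian $2 h_s I + 4 h_{ss} x^T x$ for $|x| =
    r$: the projection orthogonal to $x$ kills the rank-one term, so [hss] disappears. *)
Definition radial_F (r hs : R) := 2 * (n%:R - 1) * hs + 2 * c r * r * `|hs|.

(** Where the gradient vanishes, the Hessian must be a scalar matrix for [F_cvg_0] to apply. At $x =
    0$ the rank-one term is zero; at $x \ne 0$ this is ensured by requiring that [hss] vanish with
    [hs]. Elsewhere $F$ is continuous and its value is computed. *)
Lemma F_cvg_radial x (hs hss : R) : enorm x <= rho -> (hs = 0 -> hss = 0) ->
  F c w' @[w' --> F_filter
    (x, (2 * hs) *: x, (2 * hs)%:M + (4 * hss) *: (x^T *m x))]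
  --> radial_F (enorm x) hs.
Proof.
move=> xr h0; have [x0|x0] := eqVneq x 0.
  rewrite x0 scaler0 mulmx0 scaler0 addr0 /radial_F.
  rewrite enorm0 (_ : _ + _ = (n%:R - 1) * (2 * hs)); last by ring.
  by apply: F_cvg_0; rewrite -x0.
have [s0|s0] := eqVneq hs 0.
  rewrite s0 h0// !mulr0 !scale0r addr0 /radial_F normr0 !mulr0 add0r.
  by have := @F_cvg_0 x 0 xr; rewrite mulr0.
have xp : 0 < enorm x by rewrite lt_def enorm_ge0 enorm_eq0 x0.
set w := (x, _, _).
suff <- : F c w = radial_F (enorm x) hs.
  apply: F_cvg_nz => //=; rewrite enorm_eq0 scaler_eq0 negb_or x0 andbT.
  by rewrite mulf_neq0// pnatr_eq0.
rewrite FE enormZ.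
have -> : quad ((2 * hs) *: x) ((2 * hs)%:M + (4 * hss) *: (x^T *m x)) =
   (2 * hs) ^+ 2 * (2 * hs * enorm x ^+ 2 + 4 * hss * (enorm x ^+ 2) ^+ 2).
  rewrite [in X in _ = _ * (_ + _ * X)]expr2 !sqr_enorm.
  rewrite {3}/ip mulr_suml !mulr_sumr -big_split/= mulr_sumr /quad.
  apply: eq_bigr => i _.
  have entry j : ((2 * hs)%:M + (4 * hss) *: (x^T *m x)) j i =
      (2 * hs) *+ (j == i) + 4 * hss * (x 0 j * x 0 i).
    by rewrite !mxE big_ord1 !mxE.
  under [LHS]eq_bigr => j _ do rewrite entry mulrDr.
  rewrite big_split/= [RHS]mulrDr; congr (_ + _).
    rewrite (bigD1 i)//= big1 ?addr0 => [|j ji]; last by rewrite (negbTE ji) mulr0n mulr0.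
    rewrite !mxE eqxx mulr1n; ring.
  by rewrite !mulr_sumr; apply: eq_bigr => j _; rewrite !mxE; ring.
have -> : \tr ((2 * hs)%:M + (4 * hss) *: (x^T *m x)) =
   n%:R * (2 * hs) + 4 * hss * enorm x ^+ 2.
  rewrite mxtraceD mxtrace_scalar mxtraceZ -[_ *+ n]mulr_natl.
  have -> : \tr (x^T *m x) = enorm x ^+ 2.
    by rewrite sqr_enorm; apply: eq_bigr => i _; rewrite mxE big_ord1 mxE.
  by [].
rewrite normrM (@ger0_norm _ 2)// /radial_F exprMn exprMn.
rewrite real_normK ?num_real//.
by field; rewrite gt_eqF//= s0.
Qed.

Section RadialTest.
Variables (phi ht hs hss : 'rV[R]_n * R -> R).
Hypothesis phiC2 : radial_C2 phi ht hs hss.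

Lemma radial_F_usc z : (hs z = 0 -> hss z = 0) -> enorm z.1 <= rho ->
  (F_usc rho c (z.1, gradient phi z, hessian phi z)
    <= (radial_F (enorm z.1) (hs z))%:E)%E.
Proof.
move=> h0 zr; rewrite (radial_gradient phiC2) (radial_hessian phiC2).
by apply: limf_esup_le; exact: F_cvg_radial.
Qed.

Lemma radial_F_lsc z : (hs z = 0 -> hss z = 0) -> enorm z.1 <= rho ->
  ((radial_F (enorm z.1) (hs z))%:E
    <= F_lsc rho c (z.1, gradient phi z, hessian phi z))%E.
Proof.
move=> h0 zr; rewrite (radial_gradient phiC2) (radial_hessian phiC2).
by apply: limf_einf_ge; exact: F_cvg_radial.
Qed.

End RadialTest.

End Operator.

(** * A penalty in time forcing extrema to be attained *)

Section PosPow.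
Variable R : realType.

(** The truncated power $y_+^k$; the cube is already of class $C^2$. For [k = 0] it is constantly 1,
    whence the successors in the lemmas on it. *)
Definition pospow k (y : R) : R := Num.max y 0 ^+ k.

Lemma pospow_pos k y : 0 <= y -> pospow k y = y ^+ k.
Proof. by move=> y0; rewrite /pospow max_l. Qed.

Lemma pospow_neg k y : y <= 0 -> pospow k.+1 y = 0.
Proof. by move=> y0; rewrite /pospow max_r// expr0n. Qed.

Lemma pospow_ge0 k y : 0 <= pospow k y.
Proof. by rewrite exprn_ge0// le_max lexx orbT. Qed.

Lemma pospow_le k : {homo pospow k : x y / x <= y}.
Proof.
move=> x y xy; apply: lerXn2r; [by rewrite nnegrE le_max lexx orbT..|].
by rewrite ge_max !le_max xy lexx orbT.
Qed.

Lemma pospow_continuous k : continuous (pospow k).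
Proof.
move=> y; apply: (@continuous_comp _ _ _ (fun y : R => Num.max y 0) (fun y : R => y ^+ k)).
  by apply: continuous_max; [exact: cvg_id|exact: cvg_cst].
exact: exprn_continuous.
Qed.

Lemma is_derive_pospow k (y : R) :
  is_derive y 1 (pospow k.+2) (k.+2%:R * pospow k.+1 y).
Proof.
have [y0|y0|->] := ltgtP y 0.
- apply: (@near_eq_is_derive _ _ _ (cst 0)).
    by near=> x; rewrite /cst pospow_neg// ltW//; near: x; exact: lt_nbhsl.
  by rewrite pospow_neg ?ltW// mulr0; exact: is_derive_cst.
- apply: (@near_eq_is_derive _ _ _ (fun x : R => x ^+ k.+2)).
    by near=> x; rewrite pospow_pos// ltW//; near: x; exact: lt_nbhsr.
  rewrite pospow_pos ?ltW//.
  apply: DeriveDef; first exact: exprn_derivable.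
  by rewrite exp_derive /GRing.scale/= mulr1.
- rewrite pospow_neg// mulr0.
  (* At the kink the difference quotient is [pospow k.+1 h], which tends to 0. *)
  have h : h^-1 *: ((pospow k.+2 \o shift 0) (h *: 1) - pospow k.+2 0) @[h --> 0^'] --> (0 : R).
    have : pospow k.+1 h @[h --> 0^'] --> (0 : R).
      rewrite -[X in _ --> X](@pospow_neg k 0)//.
      by apply: cvg_within_filter; exact: pospow_continuous.
    apply: cvg_trans; apply: near_eq_cvg; near=> h.
    rewrite /= addr0 (@pospow_neg _ 0)// subr0 /GRing.scale/= mulr1.
    have h0 : h != 0 by near: h; exact: nbhs_dnbhs_neq.
    case: (leP h 0) => hs; first by rewrite !pospow_neg ?mulr0.
    by rewrite !pospow_pos ?ltW// [in RHS]exprS mulKf.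
  by apply: DeriveDef; [apply/cvg_ex; exists 0|exact: cvg_lim h].
Unshelve. all: by end_near. Qed.

Section Growth.
Variables (T : R) (M : nat -> R).

(* A locally finite sum: only the terms with [j < t - T] are nonzero. *)
Definition growth k (t : R) : R :=
  \sum_(j < (Num.truncn `|t - T|).+1) M j * pospow k (t - T - j%:R).

(** The terms of index at least $t - T$ vanish, so any large enough number of terms gives the same
    value. This allows a number of terms fixed near a given time, hence termwise differentiation. *)
Lemma growthE k (t : R) N : t - T <= N%:R ->
  growth k.+1 t = \sum_(j < N) M j * pospow k.+1 (t - T - j%:R).
Proof.
move=> tN; set m := (Num.truncn `|t - T|).+1.
have tm : t - T <= m%:R.
  by apply: le_trans (ler_norm _) _; rewrite ltW// truncnS_gt.
have E p : t - T <= p%:R -> \sum_(j < p) M j * pospow k.+1 (t - T - j%:R) =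
    \sum_(j < p + (maxn m N - p)) M j * pospow k.+1 (t - T - j%:R).
  move=> tp; rewrite big_split_ord/= [X in _ = _ + X]big1 ?addr0// => j _.
  rewrite pospow_neg ?mulr0// natrD.
  by have : 0 <= j%:R :> R by []; lra.
by rewrite /growth -/m (E m)// (E N)// !subnKC ?leq_maxl ?leq_maxr.
Qed.

Lemma growth_near k (t : R) : exists N, \forall s \near t,
  \sum_(j < N) M j * pospow k.+1 (s - T - j%:R) = growth k.+1 s.
Proof.
exists (Num.truncn `|t - T|).+1; near=> s; apply/esym/growthE.
rewrite lerBlDr ltW//; near: s; apply: lt_nbhsl.
by rewrite -ltrBlDr (le_lt_trans (ler_norm _))// truncnS_gt.
Unshelve. all: by end_near. Qed.

Lemma growth_continuous k : continuous (growth k.+1).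
Proof.
move=> t; have [N h] := growth_near k t.
rewrite /continuous_at -(nbhs_singleton h).
apply: (@cvg_trans _ ((fun t : R => \sum_(j < N) M j * pospow k.+1 (t - T - j%:R)) @ t)).
  exact: near_eq_cvg.
apply: (@cvg_sumr R R (nbhs t) _ (fun (j : 'I_N) (s : R) => M j * pospow k.+1 (s - T - j%:R))
  (fun j => M j * pospow k.+1 (t - T - j%:R))) => j.
apply: cvgM; first exact: cvg_cst.
apply: (@continuous_comp _ _ _ (fun t : R => t - T - j%:R) (pospow k.+1)).
  by apply: cvgB; [apply: cvgB; [exact: cvg_id|exact: cvg_cst]|exact: cvg_cst].
exact: pospow_continuous.
Qed.

Lemma is_derive_growth k (t : R) :
  is_derive t 1 (growth k.+2) (k.+2%:R * growth k.+1 t).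
Proof.
pose m := (Num.truncn `|t - T|).+1.
have tm : t - T < m%:R.
  by rewrite (le_lt_trans (ler_norm _))// truncnS_gt.
apply: (@near_eq_is_derive _ _ _
  (\sum_(j < m) (fun t : R => M j * pospow k.+2 (t - T - j%:R)))).
  near=> s; rewrite fct_sumE; apply/esym/growthE.
  by rewrite lerBlDr ltW//; near: s; apply: lt_nbhsl; rewrite -ltrBlDr.
rewrite (growthE k (ltW tm)) mulr_sumr; apply: is_derive_sum => j.
have d : is_derive t 1 (fun t : R => t - T - j%:R) (1 : R).
  rewrite (_ : (fun _ => _) = shift (- T - j%:R)); first exact: is_derive_shift.
  by apply/funext => s; rewrite /shift addrA.
have dd : differentiable (fun t : R => t - T - j%:R) t.
  by apply/derivable1_diffP; have [] := d.
have [q qE] := @derive_comp R R _ _ _ t 1 (is_derive_pospow k) dd.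
rewrite derive_val mulr1 in qE.
have {qE}q : is_derive t 1 (pospow k.+2 \o (fun t : R => t - T - j%:R))
    (k.+2%:R * pospow k.+1 (t - T - j%:R)).
  by apply: DeriveDef => //; exact: diff_derivable.
rewrite (_ : (fun _ => _) = M j *: (pospow k.+2 \o (fun t : R => t - T - j%:R)))//.
apply: is_derive_eq.
by rewrite /GRing.scale/=; ring.
Unshelve. all: by end_near. Qed.

Hypothesis M0 : forall j, 0 <= M j.

Lemma growth_ge0 k t : 0 <= growth k t.
Proof. by apply: sumr_ge0 => j _; rewrite mulr_ge0// pospow_ge0. Qed.

Lemma growth_eq0 k t : t <= T -> growth k.+1 t = 0.
Proof. by move=> tT; rewrite (@growthE k t 0) ?big_ord0// subr_le0. Qed.

(** The term of index [j] suffices: its base is at least 1 and the other terms are nonnegative. *)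
Lemma growth_ge k t j : j%:R + 1 <= t - T -> M j <= growth k.+1 t.
Proof.
move=> jt; pose N := maxn j.+1 (Num.truncn `|t - T|).+1.
rewrite (@growthE k t N); last first.
  apply: (@le_trans _ _ (Num.truncn `|t - T|).+1%:R).
    by rewrite ltW// (le_lt_trans (ler_norm _))// truncnS_gt.
  by rewrite ler_nat leq_maxr.
have jN : (j < N)%N by rewrite leq_max leqnn.
rewrite (bigD1 (Ordinal jN))//= -[leLHS]addr0 lerD//; last first.
  by apply: sumr_ge0 => i _; rewrite mulr_ge0// pospow_ge0.
by rewrite ler_peMr// pospow_pos ?exprn_ege1//; lra.
Qed.

End Growth.
End PosPow.

Section Attain.
Variables (R : realType) (n : nat) (rho : R).
Notation spacetime := ('rV[R]_n * R)%type.
Hypothesis rho0 : 0 < rho.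

(** Adding such a function to a radial test function changes its time derivative only. *)
Definition time_only (g g' : R -> R) := radial_C2 (fun z : spacetime => g z.2)
  (fun z => g' z.2) (fun=> 0) (fun=> 0).

Lemma time_onlyP (g g' g'' : R -> R) :
  (forall t : R, is_derive t 1 g (g' t)) -> (forall t : R, is_derive t 1 g' (g'' t)) ->
  continuous g'' -> time_only g g'.
Proof.
move=> dg dg' cg''.
apply: (radial_C2_eq (radial_C2_comp dg dg' cg'' (@radial_C2_time R n))) => // z.
- by rewrite mulr1.
- by rewrite mulr0.
- by rewrite !mulr0 addr0.
Qed.

Lemma compact_cylinder T : compact (cylinder rho `&` [set z : spacetime | z.2 <= T]).
Proof.
rewrite (_ : _ `&` _ = [set x : 'rV[R]_n | enorm x <= rho] `*` `[0, T]%classic); last first.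
  apply/seteqP; split => -[x t] /=; rewrite in_itv/=.
    by move=> [[xr t0] tT]; split=> //; apply/andP.
  by move=> [xr /andP[t0 tT]].
apply: compact_setX; last exact: segment_compact.
apply: bounded_closed_compact.
  exists rho; split; first exact: num_real.
  move=> M rM x /= xr.
  apply: le_trans (ltW rM).
  rewrite [leLHS]/Num.norm/= mx_normrE; apply: bigmax_le => [|[i j] _ /=]; first exact: ltW.
  by rewrite ord1; apply: le_trans xr; exact: coord_le_enorm.
rewrite -[X in closed X]/(@enorm R n @^-1` [set r | r <= rho]).
apply: closed_comp => [x _|]; [exact: enorm_continuous|exact: closed_le].
Qed.

Lemma cylinder0 : cylinder rho (0 : spacetime).
Proof.
by split => //=; rewrite enorm0 ltW.
Qed.

(* The definition of viscosity solutions only tests at global extrema, and a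
   priori the growth of a solution as [t -> +oo] is arbitrary; the penalty [g]
   is chosen to outgrow it. *)
Lemma attain (f : spacetime -> R) (T : R) : 0 <= T ->
  {within cylinder rho, continuous f} ->
  exists g g' : R -> R, [/\ time_only g g', forall t, 0 <= g' t,
    forall t, t <= T -> g t = 0 &
    exists2 z, cylinder rho z &
      forall w, cylinder rho w -> f w - g w.2 <= f z - g z.2].
Proof.
move=> T0 cf.
pose K S := cylinder rho `&` [set z : spacetime | z.2 <= S].
have K0 S : 0 <= S -> K S 0 by move=> S0; split; [exact: cylinder0|].
have cK (h : spacetime -> R) S : {within cylinder rho, continuous h} ->
    {within K S, continuous h}.
  by apply: continuous_subspaceW => z [].
(* [M k] bounds $f - f(0)$ up to time $T + k + 2$, while the penalty exceeds [M k] from time $T + k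
   + 1$ on; these time ranges cover everything after $T + 1$. *)
have /choice[M hM] k : exists m, 0 <= m /\
    forall w, K (T + k%:R + 2) w -> f w - f 0 <= m.
  have S0 : 0 <= T + k%:R + 2 by rewrite !addr_ge0.
  have [z _ zmax] := compact_EVT_max (ex_intro _ _ (K0 _ S0))
    (@compact_cylinder (T + k%:R + 2)) (cK f (T + k%:R + 2) cf).
  exists (f z - f 0); split.
    by rewrite subr_ge0 zmax//; apply/mem_set/K0.
  by move=> w Kw; rewrite lerB// zmax//; exact/mem_set.
have M0 j : 0 <= M j by have [] := hM j.
pose g := growth T M 3; pose g' t := 3 * growth T M 2 t.
have tg : time_only g g'.
  apply: (@time_onlyP g g' (fun t => 3 * (2 * growth T M 1 t))).
  - exact: (@is_derive_growth R T M 1).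
  - move=> t; have d := @is_derive_growth R T M 0 t.
    exact: (is_deriveZ 3 d).
  - move=> t; apply: cvgM; first exact: cvg_cst.
    by apply: cvgM; [exact: cvg_cst|exact: (@growth_continuous R T M 0)].
exists g, g'; split => //.
- by move=> t; rewrite mulr_ge0// growth_ge0.
- by move=> t; exact: growth_eq0.
have cg : continuous (fun z : spacetime => g z.2).
  by move=> z; have [[d _ _ _] _ _] := tg; exact: differentiable_continuous.
have cfg : {within cylinder rho, continuous (fun z => f z - g z.2)}.
  by apply: within_continuousB => //; exact: continuous_subspaceT.
have T10 : 0 <= T + 1 by rewrite addr_ge0.
have [z /set_mem[zc _] zmax] := compact_EVT_max (ex_intro _ _ (K0 _ T10))
    (@compact_cylinder (T + 1)) (cK _ (T + 1) cfg).
exists z => // w cw; have [wT|Tw] := leP w.2 (T + 1).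
  by apply: zmax; exact/mem_set.
(* Late points do no better than the space-time origin, which lies in the compact part and where the
   penalty is zero. *)
apply: (@le_trans _ _ (f 0 - g 0)); last by apply: (zmax 0); apply/mem_set/K0.
rewrite [g 0]growth_eq0// subr0 lerBlDl -lerBlDr.
have w0 : 0 <= w.2 - T - 1 by lra.
have /andP[k1 k2] := truncn_itv w0; set k := Num.truncn _ in k1 k2.
rewrite -(addn1 k) natrD in k2.
apply: (@le_trans _ _ (M k)); last by apply: growth_ge => //; lra.
by have [_] := hM k; apply; split => //=; lra.
Qed.

End Attain.

(** * Comparison with strict radial barriers *)

Section Comparison.
Variables (R : realType) (n : nat) (rho : R) (c u0 : R -> R).
Notation spacetime := ('rV[R]_n * R)%type.
Variable u : spacetime -> R.
Hypothesis rho0 : 0 < rho.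
Hypothesis c_cont : {within `[0, rho], continuous c}.
Hypothesis u_cont : {within cylinder rho, continuous u}.

Variables (W ht hs hss : spacetime -> R).
Hypothesis WC2 : radial_C2 W ht hs hss.
Hypothesis degenerate : forall z, cylinder rho z -> hs z = 0 -> hss z = 0.

Let W_cont : {within cylinder rho, continuous W}.
Proof.
apply: continuous_subspaceT => z; apply: differentiable_continuous.
by have [[d _ _ _] _ _] := WC2.
Qed.

(** The penalty starts at the time of the given point, so it does not affect the value there. A
    maximum of $u - W - g$ at positive time contradicts the subsolution test: $g' \ge 0$ preserves
    the strict inequality, and $h_s > 0$ makes the normal derivative positive on the boundary. So
    the maximum is at time 0, where the initial data decide. *)
Lemma comparison_above :
  viscosity_subsolution rho c u0 u ->
  (forall z, cylinder rho z -> 0 < z.2 ->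
     radial_F n c (enorm z.1) (hs z) < ht z) ->
  (forall z, cylinder rho z -> enorm z.1 = rho -> 0 < hs z) ->
  (forall x, enorm x <= rho -> u0 (enorm x) <= W (x, 0)) ->
  forall z, cylinder rho z -> u z <= W z.
Proof.
move=> [_ uinit usub] strict bdry init [x t] xtc.
have [|g [g' [tg g'0 gT [z zc zmax]]]] := @attain _ _ _ rho0 (fun z => u z - W z) t xtc.2.
  exact: within_continuousB.
have [z0|z0] := ltP 0 z.2; last first.
  have z20 : z.2 = 0 by apply/eqP; rewrite eq_le z0 zc.2.
  have zx : z = (z.1, 0) by rewrite -z20; case: (z).
  have := zmax (x, t) xtc; rewrite /= gT// z20 gT; last exact: xtc.2.
  have := le_trans (uinit _ zc.1) (init _ zc.1); rewrite -zx; lra.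
have phiC2 := radial_C2D WC2 tg.
have := usub _ z (radial_C2_C2 phiC2) zc z0.
case=> [w wc|int bd]; first by have := zmax w wc; lra.
have hs0 : hs z + 0 = 0 -> hss z + 0 = 0.
  by rewrite !addr0; exact: degenerate.
have := @radial_F_usc _ _ _ c c_cont _ _ _ _ phiC2 z hs0 zc.1.
rewrite (radial_time_deriv phiC2) addr0 in int bd *.
set E := F_usc _ _ _ in int bd * => EF.
have Epos : (0 < (ht z + g' z.2)%:E - E)%E.
  apply: (@lt_le_trans _ _ ((ht z + g' z.2)%:E - (radial_F n c (enorm z.1) (hs z))%:E)%E).
    rewrite -EFinB lte_fin; have := strict z zc z0; have := g'0 z.2; lra.
  by rewrite leeB.
have := zc.1; rewrite le_eqVlt => /orP[/eqP zr|/int]; last by rewrite leNgt Epos.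
have := bd zr; rewrite leNgt lt_min Epos/= (radial_normal_deriv phiC2 rho0 zr) lte_fin.
by rewrite addr0 mulr_gt0// mulr_gt0// bdry.
Qed.

(** The mirror argument at a maximum of $W - u - g$, with test function $W - g$. *)
Lemma comparison_below :
  viscosity_supersolution rho c u0 u ->
  (forall z, cylinder rho z -> 0 < z.2 ->
     ht z < radial_F n c (enorm z.1) (hs z)) ->
  (forall z, cylinder rho z -> enorm z.1 = rho -> hs z < 0) ->
  (forall x, enorm x <= rho -> W (x, 0) <= u0 (enorm x)) ->
  forall z, cylinder rho z -> W z <= u z.
Proof.
move=> [_ uinit usup] strict bdry init [x t] xtc.
have [|g [g' [tg g'0 gT [z zc zmax]]]] := @attain _ _ _ rho0 (fun z => W z - u z) t xtc.2.
  exact: within_continuousB.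
have [z0|z0] := ltP 0 z.2; last first.
  have z20 : z.2 = 0 by apply/eqP; rewrite eq_le z0 zc.2.
  have zx : z = (z.1, 0) by rewrite -z20; case: (z).
  have := zmax (x, t) xtc; rewrite /= gT// z20 gT; last exact: xtc.2.
  have := le_trans (init _ zc.1) (uinit _ zc.1); rewrite -zx; lra.
(* The term $-g$ is entered as a product with the constant $-1$; [E1] and [E2] clean up the
   resulting derivatives. *)
have phiC2 := radial_C2D WC2 (radial_C2M (radial_C2_cst n (-1)) tg).
have := usup _ z (radial_C2_C2 phiC2) zc z0.
case=> [w wc|int bd]; first by have := zmax w wc; lra.
have E1 w : hs w + (0 * g w.2 + -1 * 0) = hs w by ring.
have hs0 : hs z + (0 * g z.2 + -1 * 0) = 0 ->
   hss z + (0 * g z.2 + 0 * 0 + (0 * 0 + -1 * 0)) = 0.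
  by rewrite E1 => /(degenerate zc) ->; ring.
have := @radial_F_lsc _ _ _ c c_cont _ _ _ _ phiC2 z hs0 zc.1.
rewrite (radial_time_deriv phiC2) E1 in int bd *.
have E2 : ht z + (0 * g z.2 + -1 * g' z.2) = ht z - g' z.2 by ring.
rewrite E2 in int bd.
set E := F_lsc _ _ _ in int bd * => EF.
have Eneg : ((ht z - g' z.2)%:E - E < 0)%E.
  apply: (@le_lt_trans _ _ ((ht z - g' z.2)%:E - (radial_F n c (enorm z.1) (hs z))%:E)%E).
    by rewrite leeB.
  rewrite -EFinB lte_fin; have := strict z zc z0; have := g'0 z.2; lra.
have := zc.1; rewrite le_eqVlt => /orP[/eqP zr|/int]; last by rewrite leNgt Eneg.
have := bd zr; rewrite leNgt gt_max Eneg/= (radial_normal_deriv phiC2 rho0 zr) lte_fin.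
by rewrite E1 pmulr_llt0// pmulr_rlt0// bdry.
Qed.

End Comparison.

(** * Barriers *)

Section Barriers.
Variables (R : realType) (n : nat).
Notation spacetime := ('rV[R]_n * R)%type.
Implicit Type z : spacetime.

Lemma radial_C2_exp (k : R) : radial_C2 (fun z => expR (k * z.2))
  (fun z => k * expR (k * z.2)) (fun=> 0) (fun=> 0).
Proof.
have h := radial_C2_comp (@is_derive_expR R) (@is_derive_expR R)
  (@continuous_expR R) (radial_C2M (radial_C2_cst n k) (@radial_C2_time R n)).
by apply: (radial_C2_eq h) => // z; ring.
Qed.

Lemma radial_C2_pospow phi ht hs hss : @radial_C2 R n phi ht hs hss ->
  radial_C2 (fun z => pospow 3 (phi z)) (fun z => 3 * pospow 2 (phi z) * ht z)
    (fun z => 3 * pospow 2 (phi z) * hs z)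
    (fun z => 6 * pospow 1 (phi z) * hs z ^+ 2 + 3 * pospow 2 (phi z) * hss z).
Proof.
move=> h.
have d2 (y : R) : is_derive y 1 (fun y => 3 * pospow 2 y) (3 * (2 * pospow 1 y)).
  have d := @is_derive_pospow R 0 y; exact: (is_deriveZ 3 d).
have cc : continuous (fun y : R => 3 * (2 * pospow 1 y)).
  move=> y; apply: cvgM; first exact: cvg_cst.
  by apply: cvgM; [exact: cvg_cst|exact: pospow_continuous].
have h' := radial_C2_comp (@is_derive_pospow R 1) d2 cc h.
by apply: (radial_C2_eq h') => // z; ring.
Qed.

Variables (al be m K eps q1 sg : R) (psi psit : spacetime -> R).
Hypothesis psiC2 : radial_C2 psi psit (fun=> sg) (fun=> 0).

(** One formula serves both families. From below, [psi] is $s - a^2$ with [sg = 1], the amplitude is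
    negative and [eps = 0]; from above, [psi] is $q(t) - s$ with [sg = -1], and [eps] is
    positive. *)
Definition barrier z := al + be * z.2 + m * expR (K * z.2) * pospow 3 (psi z)
  + eps * pospow 3 (sqn z - q1).

Definition barrier_t z := be + m * expR (K * z.2) *
  (K * pospow 3 (psi z) + 3 * pospow 2 (psi z) * psit z).

Definition barrier_s z := m * expR (K * z.2) * (3 * pospow 2 (psi z) * sg)
  + eps * (3 * pospow 2 (sqn z - q1)).

Definition barrier_ss z := m * expR (K * z.2) * (6 * pospow 1 (psi z) * sg ^+ 2)
  + eps * (6 * pospow 1 (sqn z - q1)).

Lemma barrier_C2 : radial_C2 barrier barrier_t barrier_s barrier_ss.
Proof.
have c k := radial_C2_cst n (k : R).
have h1 := radial_C2D (c al) (radial_C2M (c be) (@radial_C2_time R n)).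
have h2 := radial_C2M (radial_C2M (c m) (radial_C2_exp K)) (radial_C2_pospow psiC2).
have h3 := radial_C2M (c eps)
  (radial_C2_pospow (radial_C2D (@radial_C2_sqn R n) (c (- q1)))).
apply: (radial_C2_eq (radial_C2D (radial_C2D h1 h2) h3)) => // z.
- by rewrite /barrier_t; ring.
- by rewrite /barrier_s; ring.
- by rewrite /barrier_ss; ring.
Qed.

End Barriers.

(** * Explicit lower and upper bounds on the solution *)

Section Bounds.
Variables (R : realType) (n : nat) (rho : R) (c u0 : R -> R).
Notation spacetime := ('rV[R]_n * R)%type.
Implicit Type z : spacetime.
Variable u : spacetime -> R.
Hypothesis rho0 : 0 < rho.
Hypothesis c_cont : {within `[0, rho], continuous c}.
Hypothesis u_sol : viscosity_solution rho c u0 u.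

(* [2 * hs * drift |x|] is the right-hand side of the equation for a radially
   nonincreasing function. *)
Definition drift r := n%:R - 1 - c r * r.

Lemma sqn_enorm z : sqn z = enorm z.1 ^+ 2.
Proof. by rewrite sqr_enorm. Qed.

Lemma pospow3 y : pospow 3 y = pospow 2 y * pospow 1 y :> R.
Proof. by rewrite /pospow expr1 -exprSr. Qed.

(** For a cube, the second derivative vanishes wherever the first does; this yields the hypothesis
    [degenerate] for the barriers. *)
Lemma pospow1_eq0 y : pospow 2 y = 0 -> pospow 1 y = 0 :> R.
Proof. by rewrite /pospow expr1 => /eqP; rewrite expf_eq0/= => /eqP. Qed.

(** Removes, in the limit, the small slope [be] that makes a barrier strict. *)
Lemma le_of_slope (A B t : R) : 0 <= t ->
  (forall be, 0 < be -> A <= B + be * t) -> A <= B.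
Proof.
move=> t0 h; apply/ler_addgt0Pr => e e0.
have t1 : 0 < t + 1 by lra.
have := h (e / (t + 1)) (divr_gt0 e0 t1).
have : e / (t + 1) * t <= e by rewrite mulrAC ler_pdivrMr//; nra.
lra.
Qed.

(** With $P_k = (s - a^2)_+^k$, the exponential contributes $6 C P_2 P_1$ to the time derivative and
    the operator contributes $6 P_2$ times the drift. Hence the rate $6C$; the slope [be] makes the
    inequality strict. *)
Lemma lower_bound (a C al m : R) : 0 < a < rho -> 0 <= C ->
  (forall r, a <= r <= rho -> drift r <= C * (r ^+ 2 - a ^+ 2)) -> 0 < m ->
  (forall r, 0 <= r <= rho -> al - m * pospow 3 (r ^+ 2 - a ^+ 2) <= u0 r) ->
  forall z, cylinder rho z ->
    al - m * expR (6 * C * z.2) * pospow 3 (sqn z - a ^+ 2) <= u z.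
Proof.
move=> /andP[a0 arho] C0 hC m0 init z zc.
apply: (le_of_slope zc.2) => be be0; rewrite -lerBlDr.
have psiC2 := radial_C2D (@radial_C2_sqn R n) (radial_C2_cst n (- a ^+ 2)).
have {}psiC2 : radial_C2 (fun z => sqn z - a ^+ 2) (fun=> 0) (fun=> 1) (fun=> 0).
  by apply: (radial_C2_eq psiC2) => // w; rewrite addr0.
have bC2 := barrier_C2 al (- be) (- m) (6 * C) 0 0 psiC2.
have [ucont _ usup] := u_sol.
have := comparison_below rho0 c_cont ucont bC2 _ usup _ _ _ zc.
rewrite /barrier !mul0r addr0 !mulNr [leLHS]addrAC; apply.
- move=> w _; rewrite /barrier_s /barrier_ss !mul0r !addr0 !mulNr => /eqP.
  rewrite oppr_eq0 mulf_eq0 gt_eqF ?mulr_gt0 ?expR_gt0//= mulr1 mulf_eq0/=.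
  rewrite pnatr_eq0/= => /eqP/pospow1_eq0 ->; ring.
- move=> w wc w0; rewrite /barrier_t /barrier_s /radial_F !mul0r mulr0 !addr0 mulr1.
  pose E := m * expR (6 * C * w.2).
  have E0 : 0 < E by rewrite mulr_gt0 ?expR_gt0.
  set P2 := pospow 2 _; have P20 : 0 <= P2 by exact: pospow_ge0.
  have -> : - m * expR (6 * C * w.2) = - E by rewrite mulNr.
  have E0' := ltW E0.
  rewrite !mulNr normrN ger0_norm; last by apply: mulr_ge0 => //; apply: mulr_ge0.
  rewrite pospow3 -/P2; set P1 := pospow 1 _.
  suff H : P2 * drift (enorm w.1) <= P2 * (C * P1).
    have : E * (P2 * drift (enorm w.1)) <= E * (P2 * (C * P1)) by rewrite ler_pM2l.
    rewrite /drift; lra.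
  have [r|r] := lerP (enorm w.1) a.
    have -> : P2 = 0; last by rewrite !mul0r.
    rewrite /P2 pospow_neg// subr_le0 sqn_enorm.
    by rewrite lerXn2r// nnegrE ?enorm_ge0 ?ltW.
  have d := hC (enorm w.1); rewrite (ltW r) wc.1 in d.
  rewrite ler_wpM2l//; apply: (le_trans (d isT)).
  by rewrite /P1 pospow_pos sqn_enorm ?expr1// subr_ge0 lerXn2r ?nnegrE ?enorm_ge0 ?ltW.
- move=> w wc wr; rewrite /barrier_s mul0r addr0 mulr1 mulNr mulNr oppr_lt0.
  apply: mulr_gt0; first by rewrite mulr_gt0 ?expR_gt0.
  apply: mulr_gt0 => //; rewrite pospow_pos sqn_enorm wr.
    by rewrite exprn_gt0// subr_gt0 ltrXn2r ?nnegrE ?ltW.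
  by rewrite subr_ge0 lerXn2r ?nnegrE ?ltW.
- move=> x xr; rewrite /barrier mulr0 addr0 mul0r addr0 mulr0 expR0 mulr1 mulNr.
  by rewrite sqn_enorm init// enorm_ge0.
Qed.

(* The front [s = q t] slides from [b1^2] down to [a2^2], at a speed dominated by
   [drift]. *)
Lemma upper_bound (n0 : (0 < n)%N) (a1 a2 b1 v0 Cmax : R) :
  0 < a1 -> a1 < a2 -> a2 < b1 -> b1 < rho -> 0 < v0 ->
  (forall r, a1 <= r <= b1 -> v0 <= drift r) ->
  (forall r, 0 <= r <= rho -> 0 <= c r <= Cmax) ->
  exists kap K, 0 < kap /\ forall al m, 0 <= m ->
  (forall r, 0 <= r <= rho -> u0 r <= al + m * pospow 3 (b1 ^+ 2 - r ^+ 2)) ->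
  forall z, cylinder rho z ->
    u z <= al + m * expR (K * z.2) *
      pospow 3 (a2 ^+ 2 + (b1 ^+ 2 - a2 ^+ 2) * expR (- kap * z.2) - sqn z).
Proof.
move=> a10 a12 a2b b1rho v00 hv hc.
have sq x y : 0 < x -> x < y -> x ^+ 2 < y ^+ 2 :> R.
  by move=> x0 xy; rewrite ltrXn2r// ?nnegrE ltW// (lt_trans x0).
have ab : a2 ^+ 2 < b1 ^+ 2 by apply: sq => //; lra.
have d0 : a1 ^+ 2 < a2 ^+ 2 by exact: sq.
set q1 := b1 ^+ 2 in ab *; set q2 := a2 ^+ 2 in ab d0 *.
have Cmax0 : 0 <= Cmax.
  by have := hc 0; rewrite lexx ltW// => /(_ isT)/andP[]; exact: le_trans.
have kap0 : 0 < v0 / (q1 - q2) by rewrite divr_gt0// subr_gt0.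
(* With this rate, $-q'(t) = kap\,(q_1 - q_2) e^{-kap\, t} \le v_0$. *)
exists (v0 / (q1 - q2)); set kap := v0 / _ in kap0 *.
have kapE : kap * (q1 - q2) = v0 by rewrite /kap divfK// gt_eqF// subr_gt0.
(* For $r < a_1$ the drift is only known to be at least $-Cmax\, rho$, but there $q - s \ge q_2 -
   a_1^2$; this [K] makes $K (q - s)$ absorb both $3 v_0$ and $6\, Cmax\, rho$. *)
pose K := (3 * v0 + 6 * (Cmax * rho)) / (q2 - a1 ^+ 2).
have K0 : 0 <= K.
  have v00' := ltW v00; have rho0' := ltW rho0; have d0' := ltW d0.
  by rewrite /K divr_ge0 ?subr_ge0// addr_ge0// !mulr_ge0.
exists K; split => // al m m0 init z zc.
(* Chosen so that the outer cube with coefficient [be / B] contributes less than [be] to the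
   operator: its square factor is at most $rho^4$. *)
pose B := 6 * (rho ^+ 2) ^+ 2 * (n%:R + Cmax * rho) + 1.
have B0 : 0 < B.
  have rho0' := ltW rho0.
  by rewrite /B ltr_pwDr// !mulr_ge0// ?sqr_ge0// addr_ge0// mulr_ge0.
(* The total coefficient of [be] in the barrier once [eps] is [be / B], so that the slope and the
   outer cube disappear together. *)
pose k := z.2 + pospow 3 (sqn z - q1) / B.
have k0 : 0 <= k by rewrite addr_ge0 ?zc.2// divr_ge0 ?pospow_ge0// ltW.
apply: (le_of_slope k0) => be be0.
pose q (t : R) := q2 + (q1 - q2) * expR (- kap * t).
have psiC2 : radial_C2 (fun z => q z.2 - sqn z)
  (fun z => - kap * (q1 - q2) * expR (- kap * z.2)) (fun=> -1) (fun=> 0).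
  have cC2 k := radial_C2_cst n (k : R).
  have h := radial_C2D (radial_C2D (cC2 q2) (radial_C2M (cC2 (q1 - q2))
    (radial_C2_exp n (- kap)))) (radial_C2M (cC2 (-1)) (@radial_C2_sqn R n)).
  by apply: (radial_C2_eq h) => // w; rewrite /q; ring.
pose eps := be / B.
have eps0 : 0 < eps by rewrite divr_gt0.
have bC2 := barrier_C2 al be m K eps q1 psiC2.
have qq1 (w : spacetime) : cylinder rho w -> q2 <= q w.2 <= q1.
  move=> wc; have e1 : expR (- kap * w.2) <= 1.
    by rewrite -expR0 ler_expR mulNr oppr_le0 mulr_ge0 ?wc.2// ltW.
  have e0 := expR_ge0 (- kap * w.2).
  by rewrite /q; apply/andP; split; nra.
(* Since $q(t) \le q_1$, the two cubes are never active at the same point, so their derivatives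
   cannot cancel. *)
have key (w : spacetime) : cylinder rho w ->
    (sqn w < q w.2 /\ pospow 1 (sqn w - q1) = 0 /\ pospow 2 (sqn w - q1) = 0) \/
    (pospow 1 (q w.2 - sqn w) = 0 /\ pospow 2 (q w.2 - sqn w) = 0).
  move=> wc; have /andP[_ qw] := qq1 w wc.
  have [sw|sw] := ltP (sqn w) (q w.2).
    by left; split => //; rewrite !pospow_neg// subr_le0 (le_trans (ltW sw)).
  by right; rewrite !pospow_neg// subr_le0.
have [ucont usub _] := u_sol.
have := comparison_above rho0 c_cont ucont bC2 _ usub _ _ _ zc.
rewrite (_ : barrier _ _ _ _ _ _ _ z = al + m * expR (K * z.2) *
   pospow 3 (q z.2 - sqn z) + be * k); last first.
  by rewrite /barrier /k /eps; ring.
apply.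
- move=> w wc; rewrite /barrier_s /barrier_ss.
  have [[_ [-> ->]]|[-> ->]] := key w wc.
    rewrite !mulr0 !addr0 mulrN1 mulrN => /eqP; rewrite oppr_eq0 mulrCA mulf_eq0.
    rewrite pnatr_eq0/= mulf_eq0 => /orP[/eqP ->|/eqP/pospow1_eq0 ->]; ring.
  rewrite !mulr0 !mul0r !mulr0 !add0r => /eqP.
  rewrite mulf_eq0 gt_eqF//= mulf_eq0 pnatr_eq0/= => /eqP/pospow1_eq0 ->; ring.
- move=> w wc w0; rewrite /barrier_t /barrier_s /radial_F.
  have r0 := enorm_ge0 w.1; set r := enorm w.1 in r0 *.
  have rr : r <= rho by exact: wc.1.
  have /andP[c0 cC] : 0 <= c r <= Cmax by apply: hc; rewrite r0.
  have cr : c r * r <= Cmax * rho by exact: ler_pM.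
  have n1 : 1 <= n%:R :> R by rewrite ler1n.
  set E := m * expR _.
  have E0 : 0 <= E by rewrite mulr_ge0 ?expR_ge0.
  have [[sw [_ ->]]|[P1 P2]] := key w wc.
    rewrite !mulr0 addr0 pospow3.
    set P2 := pospow 2 (q _ - _); have P20 : 0 <= P2 by exact: pospow_ge0.
    rewrite mulrN1 mulrN normrN ger0_norm; last by apply: mulr_ge0 => //; apply: mulr_ge0.
    have -> : pospow 1 (q w.2 - sqn w) = q w.2 - sqn w.
      by rewrite pospow_pos ?expr1// subr_ge0 ltW.
    set x := expR _; have x0 : 0 <= x by exact: expR_ge0.
    have x1 : x <= 1.
      by rewrite -expR0 ler_expR mulNr oppr_le0 mulr_ge0 ?wc.2// ltW.
    have -> : - kap * (q1 - q2) * x = - (v0 * x) by rewrite -kapE; ring.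
    (* After factoring out $E P_2$. If $r \ge a_1$, then $s < q \le b_1^2$ puts $r$ in $[a_1, b_1]$
       and $6 v_0$ from the drift beats $3 v_0$ from the front; if $r < a_1$, the term in [K] is
       large enough. *)
    suff H : 0 <= K * (q w.2 - sqn w) + 3 * - (v0 * x) + 6 * drift r.
      have : 0 <= E * (P2 * (K * (q w.2 - sqn w) + 3 * - (v0 * x) + 6 * drift r)).
        by apply: mulr_ge0 => //; apply: mulr_ge0.
      rewrite /drift; lra.
    have vx : v0 * x <= v0 by rewrite ler_piMr// ltW.
    have [a1r|ra1] := lerP a1 r.
      have rb : r <= b1.
        have : r ^+ 2 <= b1 ^+ 2.
          by rewrite -sqn_enorm (le_trans (ltW sw))//; have /andP[] := qq1 w wc.
        by rewrite ler_sqr ?nnegrE//; lra.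
      have := hv r; rewrite a1r rb => /(_ isT) vr.
      have : 0 <= K * (q w.2 - sqn w) by rewrite mulr_ge0// subr_ge0 ltW.
      lra.
    have : K * (q2 - a1 ^+ 2) <= K * (q w.2 - sqn w).
      rewrite ler_wpM2l// lerB//; first by have /andP[] := qq1 w wc.
      by rewrite sqn_enorm lerXn2r ?nnegrE// ltW.
    rewrite /K divfK ?gt_eqF ?subr_gt0// /drift; lra.
  rewrite pospow3 P1 P2 !(mulr0, mul0r, add0r, addr0).
  set P := pospow 2 (sqn w - q1).
  have P0 : 0 <= P by exact: pospow_ge0.
  have PB : P <= (rho ^+ 2) ^+ 2.
    rewrite -(pospow_pos 2 (sqr_ge0 rho)); apply: pospow_le.
    rewrite sqn_enorm lerBlDr.
    have : r ^+ 2 <= rho ^+ 2 by rewrite lerXn2r ?nnegrE// ltW.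
    have : 0 <= q1 by exact: sqr_ge0.
    rewrite -/r; lra.
  have eps0' := ltW eps0.
  rewrite ger0_norm; last by apply: mulr_ge0 => //; apply: mulr_ge0.
  have beE : be = eps * B by rewrite /eps divfK// gt_eqF.
  rewrite [ltRHS]beE.
  suff : 6 * P * (n%:R + Cmax * rho) < B.
    move=> H; have : eps * (6 * P * (n%:R - 1 + c r * r)) < eps * B.
      rewrite ltr_pM2l//; apply: le_lt_trans H.
      by apply: ler_wpM2l; [exact: mulr_ge0|lra].
    lra.
  rewrite /B ltr_pwDr//; apply: ler_wpM2r; last exact: ler_wpM2l.
  by apply: addr_ge0 => //; apply: mulr_ge0 => //; exact: ltW.
- move=> w wc wr.
  have qr : q1 < rho ^+ 2 by apply: sq => //; lra.
  have /andP[_ qw] := qq1 w wc.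
  rewrite /barrier_s (pospow_neg _ (_ : q w.2 - sqn w <= 0)); last first.
    by rewrite subr_le0 sqn_enorm wr (le_trans qw)// ltW.
  rewrite mulr0 mul0r mulr0 add0r; apply: mulr_gt0 => //.
  apply: mulr_gt0 => //; rewrite pospow_pos sqn_enorm wr.
    by rewrite exprn_gt0// subr_gt0.
  by rewrite subr_ge0 ltW.
- move=> x xr; rewrite /barrier /q/= !mulr0 expR0 !mulr1 addr0.
  apply: le_trans (init _ _) _; first by rewrite enorm_ge0.
  rewrite sqn_enorm/= (_ : q2 + (q1 - q2) = q1); last by ring.
  by rewrite lerDl mulr_ge0 ?pospow_ge0// ltW.
Qed.

End Bounds.

(** * The long-time limit *)

Section OneVariable.
Variable R : realType.
Implicit Types (A : set R) (f : R -> R).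

(** Tolerance 1 in the limit of the difference quotient gives the constant $|l| + 1$. *)
Lemma deriv_within_slope A f (x l : R) : has_deriv_within A f x l ->
  exists2 d, 0 < d & forall y, A y -> `|y - x| < d ->
    `|f y - f x| <= (`|l| + 1) * `|y - x|.
Proof.
move=> /cvgrPdist_le /(_ 1 ltr01); rewrite /dnbhs !near_withinE.
move=> /nbhs_ballP[d /= d0 h]; exists d => // y Ay yd.
have [->|yx] := eqVneq y x; first by rewrite !subrr normr0 mulr0.
have := h y; rewrite /ball/= distrC => /(_ yd yx Ay) hl.
have -> : f y - f x = (f y - f x) / (y - x) * (y - x).
  by rewrite divfK// subr_eq0.
rewrite normrM ler_wpM2r//; apply: le_trans (_ : _ <= `|l| + `|l - (f y - f x) / (y - x)|) _.
  by rewrite -[X in `|X| <= _](subKr l); exact: ler_normB.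
by rewrite lerD2l.
Qed.

Lemma deriv_within_continuous A f : (forall x, A x -> exists l, has_deriv_within A f x l) ->
  {within A, continuous f}.
Proof.
move=> h; apply/subspace_continuousP => x Ax.
have [l /deriv_within_slope[d d0 hd]] := h x Ax.
apply/cvgrPdist_le => e e0; apply/nbhs_ballP.
have l0 : 0 < `|l| + 1 by rewrite ltr_pwDr.
exists (Num.min d (e / (`|l| + 1))); first by rewrite /= lt_min d0 divr_gt0.
move=> y; rewrite /ball/= lt_min distrC => /andP[yd ye] Ay.
rewrite distrC (le_trans (hd y Ay yd))// mulrC -ler_pdivlMr//; exact: ltW.
Qed.

Lemma continuous_within_dist A f x e : {within A, continuous f} -> A x -> 0 < e ->
  exists2 d, 0 < d & forall y, A y -> `|y - x| < d -> `|f y - f x| <= e.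
Proof.
move=> /subspace_continuousP h Ax e0.
have /cvgrPdist_le /(_ e e0) /nbhs_ballP[d /= d0 hd] := h x Ax.
exists d => // y Ay yd; rewrite distrC; apply: hd => //.
by rewrite /ball/= distrC.
Qed.

End OneVariable.

(** * Consequences for the given forcing term and initial datum *)

Section Radial.
Variables (R : realType) (n : nat) (rho a b : R) (c u0 : R -> R).
Variable u : 'rV[R]_n * R -> R.
Hypothesis n0 : (0 < n)%N.
Hypothesis rho0 : 0 < rho.
Hypothesis c_C1 : C1_on `[0, rho] c.
Hypothesis c_ge0 : forall r, 0 <= r <= rho -> 0 <= c r.
Hypothesis u0_cont : {within `[0, rho], continuous u0}.
Hypothesis a0 : 0 < a.
Hypothesis ab : a < b.
Hypothesis brho : b < rho.
Hypothesis c_a : c a = (n.-1)%:R / a.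
Hypothesis c_ab : forall r, a < r < b -> c r < (n.-1)%:R / r.
Hypothesis u0_1 : forall r, 0 <= r <= a -> u0 r = 1.
Hypothesis u0_ab : forall r, a < r < b -> 0 < u0 r < 1.
Hypothesis u0_0 : forall r, b <= r <= rho -> u0 r = 0.
Hypothesis u_sol : viscosity_solution rho c u0 u.

Let c_cont : {within `[0, rho], continuous c}.
Proof.
have [c' [h _]] := c_C1.
by apply: deriv_within_continuous => x Ax; exists (c' x); exact: h.
Qed.

Let radii : [/\ 0 < a, a < b & b < rho]. Proof. by []. Qed.

Let predn_natr : (n.-1)%:R = n%:R - 1 :> R.
Proof. by rewrite -subn1 natrB. Qed.

Let n1 : 0 <= n%:R - 1 :> R.
Proof. by rewrite -predn_natr. Qed.

Let u0_itv r : 0 <= r <= rho -> 0 <= u0 r <= 1.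
Proof.
move=> /andP[r0 rr]; have [ra|ar] := lerP r a.
  by rewrite u0_1 ?r0// ler01 lexx.
have [br|rb] := lerP b r; first by rewrite u0_0 ?br// lexx ler01.
by have /andP[/ltW -> /ltW ->] := u0_ab (introT andP (conj ar rb)).
Qed.

Let c_bounded : exists Cmax, forall r, 0 <= r <= rho -> 0 <= c r <= Cmax.
Proof.
have [x _ xmax] := EVT_max (ltW rho0) c_cont.
exists (c x) => r rr; rewrite c_ge0//=; apply: xmax; by rewrite in_itv.
Qed.

(* [drift] vanishes at [a] and [c] is Lipschitz there. *)
Let drift_le : exists2 C, 0 <= C &
  forall r, a <= r <= rho -> drift n c r <= C * (r ^+ 2 - a ^+ 2).
Proof.
have [c' [h _]] := c_C1.
have arho : a <= rho by rewrite ltW// (lt_trans ab).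
have Aa : `[0, rho]%classic a by rewrite /= in_itv/= ltW.
have [d d0 hd] := deriv_within_slope (h a Aa).
set L := _ + 1 in hd; have L0 : 0 <= L by rewrite /L addr_ge0.
have C1 : 0 <= L * rho / a by rewrite divr_ge0 ?mulr_ge0// ltW.
have C2 : 0 <= (n%:R - 1) / (d * a) by rewrite divr_ge0// mulr_ge0// ltW.
(* The first summand handles $r - a < d$, by the Lipschitz bound on [c]; the second handles $r - a
   \ge d$, where the drift is at most $n - 1$ and $r^2 - a^2 \ge d a$. *)
exists (L * rho / a + (n%:R - 1) / (d * a)); first exact: addr_ge0.
move=> r /andP[ar rr]; have r0 : 0 <= r by rewrite (le_trans _ ar)// ltW.
have -> : r ^+ 2 - a ^+ 2 = (r - a) * (r + a) by ring.
have ra0 : 0 <= r - a by rewrite subr_ge0.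
have rp : 0 <= (r - a) * (r + a) by rewrite mulr_ge0// addr_ge0// ltW.
have cr0 : 0 <= c r by rewrite c_ge0// r0.
have ca0 : 0 <= c a by rewrite c_ge0// ltW.
have caE : c a * a = n%:R - 1 by rewrite c_a predn_natr divfK// gt_eqF.
rewrite mulrDl /drift; have [rd|dr] := ltP `|r - a| d.
  have : `|c r - c a| <= L * `|r - a| by apply: hd; rewrite //= in_itv/= r0.
  rewrite (ger0_norm ra0) ler_norml => /andP[hc _].
  have : n%:R - 1 - c r * r <= L * rho * (r - a).
    have h1 : 0 <= (c r - c a + L * (r - a)) * r by rewrite mulr_ge0//; lra.
    have h2 : 0 <= c a * (r - a) by rewrite mulr_ge0.
    have h3 : 0 <= L * (r - a) * (rho - r) by rewrite !mulr_ge0// subr_ge0.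
    nra.
  have : L * rho * (r - a) <= L * rho / a * ((r - a) * (r + a)).
    have -> : L * rho / a * ((r - a) * (r + a)) =
        L * rho * (r - a) + L * rho * (r - a) * (r / a).
      by field; rewrite gt_eqF.
    by rewrite lerDl !mulr_ge0 ?invr_ge0// ltW.
  have : 0 <= (n%:R - 1) / (d * a) * ((r - a) * (r + a)) by rewrite mulr_ge0.
  lra.
rewrite (ger0_norm ra0) in dr.
have : 0 <= L * rho / a * ((r - a) * (r + a)) by rewrite mulr_ge0.
have : (n%:R - 1) <= (n%:R - 1) / (d * a) * ((r - a) * (r + a)).
  rewrite mulrAC ler_pdivlMr ?mulr_gt0// ler_wpM2l//.
  by apply: ler_pM => //; [exact: ltW|exact: ltW|rewrite lerDr].
have : 0 <= c r * r by rewrite mulr_ge0.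
lra.
Qed.

Let drift_gt0 r : a < r < b -> 0 < drift n c r.
Proof.
move=> rab; have /andP[ar _] := rab; have r0 : 0 < r by rewrite (lt_trans a0).
have := c_ab rab; rewrite ltr_pdivlMr// predn_natr /drift; lra.
Qed.

(** On a compact subinterval of $(a, b)$ the continuous positive drift attains its minimum. *)
Let drift_ge a1 b1 : a < a1 -> a1 <= b1 -> b1 < b ->
  exists2 v0, 0 < v0 & forall r, a1 <= r <= b1 -> v0 <= drift n c r.
Proof.
move=> a1a ab1 b1b.
have cd : {within `[a1, b1], continuous (drift n c)}.
  have sub : `[a1, b1]%classic `<=` `[0, rho]%classic.
    move=> r /=; rewrite !in_itv/= => /andP[h1 h2]; apply/andP; split.
      by rewrite (le_trans _ h1)// ltW// (lt_trans a0).
    by rewrite (le_trans h2)// ltW// (lt_trans b1b).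
  have cc := continuous_subspaceW sub c_cont.
  move=> r; apply: cvgB; first exact: cvg_cst.
  apply: cvgM; first exact: cc.
  by apply: continuous_subspaceT => ?; exact: cvg_id.
have [x xab xmin] := EVT_min ab1 cd.
rewrite in_itv/= in xab; have /andP[x1 x2] := xab.
exists (drift n c x); first
  by apply: drift_gt0; rewrite (lt_le_trans a1a)//= (le_lt_trans x2).
by move=> r rab; apply: xmin; rewrite in_itv.
Qed.

Let arho : 0 < a < rho.
Proof. by rewrite a0 (lt_trans ab). Qed.

Lemma sol_ge0 z : cylinder rho z -> 0 <= u z.
Proof.
have [C C0 hC] := drift_le.
(* Here the vanishing slope is the amplitude [m] of the barrier, with [al = 0]. *)
move=> zc; apply: (@le_of_slope _ _ _ (expR (6 * C * z.2) * pospow 3 (sqn z - a ^+ 2))).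
  by rewrite mulr_ge0 ?expR_ge0 ?pospow_ge0.
move=> m m0; have := @lower_bound _ _ _ _ _ _ rho0 c_cont u_sol _ _ 0 m arho C0 hC m0 _ z zc.
move=> h; rewrite -lerBlDr mulrA; apply: h => r rr.
have /andP[u00 _] := u0_itv rr.
by rewrite sub0r (le_trans _ u00)// oppr_le0 mulr_ge0 ?pospow_ge0// ltW.
Qed.

(** Inside radius [a] the cube vanishes, so its amplitude may be as large as the initial comparison
    demands, and [al] can be $1 - e$ for any $e > 0$. *)
Lemma sol_ge1 z : cylinder rho z -> enorm z.1 <= a -> 1 <= u z.
Proof.
have [? ? ?] := radii.
move=> zc za; have [C C0 hC] := drift_le.
apply/ler_addgt0Pr => e e0; rewrite -lerBlDr.
have Aa : `[0, rho]%classic a by rewrite /= in_itv/=; lra.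
have [d d0 hd] := continuous_within_dist u0_cont Aa e0.
(* With amplitude $1/p$ the barrier is below 0 from radius $a + d/2$ on; before that radius,
   continuity gives $u_0 \ge 1 - e$. *)
pose p := pospow 3 ((a + d / 2) ^+ 2 - a ^+ 2).
have sq : a ^+ 2 < (a + d / 2) ^+ 2 by rewrite ltrXn2r ?nnegrE//; lra.
have p0 : 0 < p by rewrite /p pospow_pos ?exprn_gt0 ?subr_gt0// subr_ge0 ltW.
have m0 : 0 < p^-1 by rewrite invr_gt0.
have := @lower_bound _ _ _ _ _ _ rho0 c_cont u_sol _ _ (1 - e) p^-1 arho C0 hC m0 _ z zc.
rewrite pospow_neg ?mulr0 ?subr0; last first.
  by rewrite subr_le0 sqn_enorm lerXn2r ?nnegrE ?enorm_ge0// ltW.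
apply=> r rr; have /andP[r0 rrho] := rr.
have P0 : 0 <= p^-1 * pospow 3 (r ^+ 2 - a ^+ 2) by rewrite mulr_ge0 ?pospow_ge0// ltW.
have [ra|ar] := lerP r a; first by rewrite u0_1 ?r0//; lra.
have [rd|dr] := ltP r (a + d / 2).
  have := hd r; rewrite /= in_itv/= rr => /(_ isT).
  rewrite ger0_norm; last by lra.
  rewrite (u0_1 (r := a)); last by lra.
  have rd' : r - a < d by lra.
  by move=> /(_ rd'); rewrite ler_norml => /andP[]; lra.
have /andP[u00 _] := u0_itv rr; apply: le_trans u00.
suff : 1 <= p^-1 * pospow 3 (r ^+ 2 - a ^+ 2) by lra.
rewrite mulrC ler_pdivlMr// mul1r /p; apply: pospow_le.
rewrite lerB// lerXn2r ?nnegrE//; lra.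
Qed.

Lemma sol_le1 z : cylinder rho z -> u z <= 1.
Proof.
have [? ? ?] := radii.
have [Cmax hCmax] := c_bounded.
(* The barrier has [m = 0] and [al = 1]: the front is absent and any ordered radii inside $(a, b)$
   serve. *)
pose s k : R := a + (b - a) * k.
have [||| v0 v00 hv] := @drift_ge (s (1/4)) (s (3/4)); rewrite /s; try lra.
have [||||kap [K [_ h]]] :=
  upper_bound rho0 c_cont u_sol n0 (a2 := s (2/4)) _ _ _ _ v00 hv hCmax;
  rewrite ?/s; try lra.
move=> zc; have := h 1 0 (lexx _) _ z zc; rewrite !mul0r addr0; apply=> r rr.
by rewrite mul0r addr0; have /andP[] := u0_itv rr.
Qed.

(** The front ends at radius [a2 < r]; once it has passed radius [r], the cube vanishes there and
    only [al = e] remains. *)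
Lemma sol_small r e : a < r <= rho -> 0 < e -> exists2 T, 0 <= T &
  forall z, cylinder rho z -> enorm z.1 = r -> T <= z.2 -> u z <= e.
Proof.
have [? ? ?] := radii.
move=> /andP[ar rrho] e0; have [Cmax hCmax] := c_bounded.
have Ab : `[0, rho]%classic b by rewrite /= in_itv/=; lra.
have [d d0 hd] := continuous_within_dist u0_cont Ab e0.
(* Between [b0] and [b] continuity gives $u_0 \le e$; the other entry of the maximum leaves room for
   [a2] below [b0]. *)
pose b0 := Num.max ((a + b) / 2) (b - d / 2).
have b0b : b0 < b by rewrite gt_max; lra.
have b0a : (a + b) / 2 <= b0 by rewrite le_max lexx.
have b0d : b - d / 2 <= b0 by rewrite le_max lexx orbT.
pose b1 := (b0 + b) / 2.
pose a2 := (a + Num.min r ((a + b) / 2)) / 2.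
have [a2a a2b a2r] : [/\ a < a2, a2 < b0 & a2 < r].
  by rewrite /a2; case: (leP r ((a + b) / 2)) => ?; split; lra.
pose a1 := (a + a2) / 2.
have [||| v0 v00 hv] := @drift_ge a1 b1; rewrite ?/a1 ?/b1; try lra.
have [||||kap [K [kap0 h]]] :=
  upper_bound rho0 c_cont u_sol n0 (a2 := a2) _ _ _ _ v00 hv hCmax;
  rewrite ?/a1 ?/b1; try lra.
have sq x y : 0 <= x -> x < y -> x ^+ 2 < y ^+ 2 :> R.
  by move=> x0 xy; rewrite ltrXn2r// ?nnegrE// ltW// (le_lt_trans x0).
have ra2 : 0 < r ^+ 2 - a2 ^+ 2 by rewrite subr_gt0 sq//; lra.
have b1a2 : 0 < b1 ^+ 2 - a2 ^+ 2 by rewrite subr_gt0 sq// /b1; lra.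
have b1b0 : b0 ^+ 2 < b1 ^+ 2 by rewrite sq// /b1; lra.
(* Amplitude $1/p$ makes the cube at least 1, hence above $u_0$, for radii up to [b0]. *)
pose p := pospow 3 (b1 ^+ 2 - b0 ^+ 2).
have p0 : 0 < p by rewrite /p pospow_pos ?exprn_gt0 ?subr_gt0// subr_ge0 ltW.
have m0 : 0 <= p^-1 by rewrite invr_ge0 ltW.
(* The front has passed [r] as soon as $e^{kap\, t} \ge D$, and $e^y \ge 1 + y$ ensures this for $t
   \ge D / kap$. *)
pose D := (b1 ^+ 2 - a2 ^+ 2) / (r ^+ 2 - a2 ^+ 2).
exists (D / kap); first by rewrite /D divr_ge0 ?divr_ge0 ?ltW.
move=> z zc zr zT; have := h e p^-1 m0 _ z zc.
rewrite pospow_neg ?mulr0 ?addr0; last first.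
  rewrite sqn_enorm zr mulNr expRN.
  suff : (b1 ^+ 2 - a2 ^+ 2) / expR (kap * z.2) <= r ^+ 2 - a2 ^+ 2 by lra.
  rewrite ler_pdivrMr ?expR_gt0// mulrC -ler_pdivrMr// -/D.
  rewrite ler_pdivrMr// mulrC in zT.
  by apply: le_trans zT _; apply: le_trans (expR_ge1Dx _); rewrite lerDr.
apply=> x xx; have /andP[x0 xrho] := xx.
have P0 : 0 <= p^-1 * pospow 3 (b1 ^+ 2 - x ^+ 2) by rewrite mulr_ge0 ?pospow_ge0.
have [bx|xb] := lerP b x; first by rewrite u0_0 ?bx//; lra.
have [xb0|b0x] := lerP x b0.
  have /andP[_ ux1] := u0_itv xx; apply: le_trans ux1 _.
  suff : 1 <= p^-1 * pospow 3 (b1 ^+ 2 - x ^+ 2) by lra.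
  rewrite mulrC ler_pdivlMr// mul1r /p; apply: pospow_le.
  rewrite lerB// lerXn2r ?nnegrE//; lra.
have := hd x; rewrite /= in_itv/= xx => /(_ isT).
rewrite (u0_0 (r := b)) ?subr0; last by lra.
rewrite ltr0_norm; last by lra.
have xd : - (x - b) < d by lra.
by move=> /(_ xd); rewrite ler_norml => /andP[]; lra.
Qed.

Lemma cylinder_ray (e : 'rV[R]_n) r t : enorm e = 1 -> 0 <= r <= rho -> 0 <= t ->
  cylinder rho (r *: e, t) /\ enorm (r *: e) = r.
Proof.
move=> e1 /andP[r0 rr] t0.
have E : enorm (r *: e : 'rV[R]_n) = r by rewrite enormZ e1 mulr1 ger0_norm.
by split => //; split => //=; rewrite E.
Qed.

Lemma profile_limit (e : 'rV[R]_n) : enorm e = 1 -> forall r, 0 <= r <= rho ->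
  profile u e r t @[t --> +oo] --> (if r <= a then 1 else 0 : R).
Proof.
move=> e1 r rr; apply/cvgrPdist_le => eps eps0.
have [ra|ar] := lerP r a.
  exists 0; split => // t t0 /=; rewrite /profile.
  have [zc zr] := cylinder_ray e1 rr (ltW t0).
  have -> : u (r *: e, t) = 1.
    by apply/eqP; rewrite eq_le sol_le1//= sol_ge1//= zr.
  by rewrite subrr normr0 ltW.
have arr : a < r <= rho by rewrite ar; have /andP[] := rr.
have [T T0 hT] := sol_small arr eps0.
exists T; split; first exact: num_real.
move=> t Tt /=; rewrite /profile.
have [zc zr] := cylinder_ray e1 rr (le_trans T0 (ltW Tt)).
by rewrite sub0r normrN ger0_norm ?sol_ge0// hT// ltW.
Qed.

(** At one late time the solution is at least 1 at radius [a] and at most 1/3 at radius $a + d$,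
    while a Lipschitz constant would allow a gap of at most 1/2. *)
Lemma not_lipschitz : ~ globally_lipschitz rho u.
Proof.
have [? ? ?] := radii.
move=> [L hL]; pose e : 'rV[R]_n := delta_mx 0 (Ordinal n0).
have e1 : enorm e = 1.
  have : enorm e ^+ 2 = 1 by rewrite sqr_enorm ip_delta mxE !eqxx.
  by move=> /eqP; rewrite sqrp_eq1 ?enorm_ge0// => /eqP.
have L0 : 0 < `|L| + 1 by rewrite ltr_pwDr.
(* The first entry keeps $a + d$ in the ball, the second gives $L d \le 1/2$; $|L| + 1$ is positive
   for every [L]. *)
pose d := Num.min (rho - a) (2 * (`|L| + 1))^-1.
have d0 : 0 < d by rewrite lt_min subr_gt0 (lt_trans ab)//= invr_gt0 mulr_gt0.
have d1 : d <= rho - a by rewrite ge_min lexx.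
have d2 : d <= (2 * (`|L| + 1))^-1 by rewrite ge_min lexx orbT.
have [||T T0 hT] := @sol_small (a + d) (1 / 3); [lra|lra|].
have ad : 0 <= a + d <= rho by lra.
have aa : 0 <= a <= rho by lra.
have [zc zr] := cylinder_ray e1 ad T0.
have [wc wr] := cylinder_ray e1 aa T0.
have := hL _ _ _ _ wc zc; rewrite subrr normr0 addr0 -scalerBl enormZ e1 mulr1.
rewrite (_ : a - (a + d) = - d); last by ring.
rewrite normrN (gtr0_norm d0) => H.
have u1 : 1 <= u (a *: e, T) by apply: sol_ge1 => //=; rewrite wr.
have u2 : u ((a + d) *: e, T) <= 1 / 3 by apply: hT => //=.
have : L * d <= 1 / 2.
  apply: (@le_trans _ _ ((`|L| + 1) * d)).
    by rewrite ler_wpM2r ?ltW//; have := ler_norm L; lra.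
  apply: (@le_trans _ _ ((`|L| + 1) * (2 * (`|L| + 1))^-1)); first by rewrite ler_wpM2l// ltW.
  by rewrite invfM mulrCA divff ?gt_eqF// mulr1 mul1r.
have := le_trans (ler_norm _) H; lra.
Qed.

End Radial.

Theorem corollary1p5 (R : realType) (n : nat) (rho a b : R) (c u0 : R -> R)
    (u : 'rV[R]_n * R -> R)
    (hn : (2 <= n)%N) (hrho : 0 < rho)
    (c_C1 : C1_on `[0, rho] c)
    (c_ge0 : forall r, 0 <= r <= rho -> 0 <= c r)
    (u0_C2 : C2_on `[0, rho] u0)
    (u0_neumann : has_deriv_within `[0, rho] u0 rho 0)
    (ha : 0 < a) (hab : a < b) (hb : b < rho)
    (c_a : c a = (n.-1)%:R / a)
    (c_b : c b = (n.-1)%:R / b)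
    (c_ab : forall r, a < r < b -> c r < (n.-1)%:R / r)
    (u0_1 : forall r, 0 <= r <= a -> u0 r = 1)
    (u0_ab : forall r, a < r < b -> 0 < u0 r < 1)
    (u0_0 : forall r, b <= r <= rho -> u0 r = 0)
    (u_sol : viscosity_solution rho c u0 u) :
  ~ globally_lipschitz rho u /\
  forall e : 'rV[R]_n, enorm e = 1 ->
  forall r : R, 0 <= r <= rho ->
    profile u e r t @[t --> +oo] --> (if r <= a then 1 else 0 : R).
Proof.
have n0 : (0 < n)%N by exact: ltnW.
have u0_cont : {within `[0, rho], continuous u0}.
  have [u0' [h _]] := u0_C2.
  by apply: deriv_within_continuous => x Ax; exists (u0' x); exact: h.
split.
  exact: (not_lipschitz n0 hrho c_C1 c_ge0 u0_cont ha hab hb).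
exact: (profile_limit n0 hrho c_C1 c_ge0 u0_cont ha hab hb).
Qed.
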